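(* For all simplicial sets $X$, $Y$, $Z$ the following identities hold between maps $C(X\times Y\times Z)\to C(X\times Y\times Z)$, where $F=\nabla\,AW$: $$F_{X,Y\times Z}\,\tilde H_{X\times Y,Z}=\tilde H_{X\times Y,Z}\,F_{X,Y\times Z},$$ $$F_{X\times Y,Z}\,\tilde H_{X,Y\times Z}=\tilde H_{X,Y\times Z}\,F_{X\times Y,Z},$$ $$\tilde H_{X\times Y,Z}\,\tilde H_{X,Y\times Z}=-\tilde H_{X,Y\times Z}\,\tilde H_{X\times Y,Z}.$$
   Context: $\Bbbk$ is a commutative ring with unit; $C(X)$ is the normalized chain complex of a simplicial set $X$ over $\Bbbk$. For a simplex $x$ write $\partial_p^qx=\partial_p\partial_{p+1}\cdots\partial_qx$ for $p\le q$ and $\partial_p^{p-1}x=x$. For a set $\alpha=\{\alpha_1<\dots<\alpha_p\}$ of non-negative integers write $s_\alpha x=s_{\alpha_p}\cdots s_{\alpha_1}x$, $s_\emptyset x=x$. A $(p,q)$-shuffle $(\alpha,\beta)\vdash(p,q)$ is a partition of $\{0,\dots,p+q-1\}$ into sets $\alpha,\beta$ of sizes $p,q$; $(-1)^{(\alpha,\beta)}$ is the sign of the permutation $(\alpha_1<\dots<\alpha_p,\beta_1<\dots<\beta_q)$. $AW_{X,Y}\colon C(X\times Y)\to C(X)\otimes C(Y)$ is $AW(x,y)=\sum_{k=0}^n\partial_{k+1}^nx\otimes\partial_0^{k-1}y$ for $(x,y)\in X_n\times Y_n$. $\nabla_{X,Y}\colon C(X)\otimes C(Y)\to C(X\times Y)$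 is $\nabla(x\otimes y)=\sum_{(\alpha,\beta)\vdash(p,q)}(-1)^{(\alpha,\beta)}(s_\beta x,s_\alpha y)$ for $p=|x|$, $q=|y|$. $F_{X,Y}=\nabla_{X,Y}\,AW_{X,Y}\colon C(X\times Y)\to C(X\times Y)$. The map $\tilde H_{X,Y}\colon C(X\times Y)\to C(X\times Y)$ (degree $+1$) is, for $(x,y)\in X_n\times Y_n$, $$\tilde H(x,y)=\sum_{p,q\ge0,\;p+q<n}\ \sum_{(\alpha,\beta)\vdash(p,q+1)}(-1)^{p+q+(\alpha,\beta)}\bigl(s_\beta\,\partial_{p+1}^{p+q}x,\ s_{p+q+1}s_\alpha\,\partial_0^{p-1}y\bigr).$$ The subscripts $X\times Y,Z$ and $X,Y\times Z$ refer to regarding $X\times Y\times Z$ as $(X\times Y)\times Z$ and $X\times(Y\times Z)$, respectively. *)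

(* Defs.v *)
From HB Require Import structures.
From mathcomp Require Import all_boot all_order all_fingroup all_algebra.
From mathcomp Require Import finmap boolp monalg.

Set Implicit Arguments.
Unset Strict Implicit.
Unset Printing Implicit Defensive.

Import GRing.Theory.
Local Open Scope ring_scope.
Local Open Scope quotient_scope.

(** * Linear algebra over an arbitrary commutative ring *)

(* The free module on T.  It is an alias of {malg k[T]} because the scaling of
   the latter is only available over nonzero rings. *)
Definition freemod (k : pzRingType) (T : choiceType) : Type := {malg k[T]}.

Section FreeModule.
Variables (k : pzRingType) (T : choiceType).
HB.instance Definition _ := GRing.Zmodule.copy (freemod k T) {malg k[T]}.

Definition fm_scale (c : k) (g : {malg k[T]}) : {malg k[T]} :=
  [malg x in msupp g => c * g@_x].

Lemma fm_scaleE c g x : (fm_scale c g)@_x = c * g@_x.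
Proof. by rewrite mcoeffE; case: msuppP; rewrite ?mulr0. Qed.

Fact fm_scaleA (a b : k) (g : freemod k T) :
  fm_scale a (fm_scale b g) = fm_scale (a * b) g.
Proof. by apply/malgP=> x; rewrite !fm_scaleE mulrA. Qed.
Fact fm_scale1 : left_id 1 (fm_scale : k -> freemod k T -> freemod k T).
Proof. by move=> g; apply/malgP=> x; rewrite fm_scaleE mul1r. Qed.
Fact fm_scaleDr :
  right_distributive (fm_scale : k -> freemod k T -> freemod k T) +%R.
Proof. by move=> a g h; apply/malgP=> x; rewrite !(mcoeffD, fm_scaleE) mulrDr. Qed.
Fact fm_scaleDl (g : freemod k T) :
  {morph (fm_scale ^~ g : k -> freemod k T) : a b / a + b}.
Proof. by move=> a b; apply/malgP=> x; rewrite !(mcoeffD, fm_scaleE) mulrDl. Qed.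

HB.instance Definition _ := GRing.Zmodule_isLmodule.Build k (freemod k T)
  fm_scaleA fm_scale1 fm_scaleDr fm_scaleDl.

Definition fm_gen (x : T) : freemod k T := << x >>.

Definition fm_ext (M : lmodType k) (f : T -> M) (u : freemod k T) : M :=
  \sum_(x <- msupp (u : {malg k[T]})) (u : {malg k[T]})@_x *: f x.

Lemma fm_ext_sub (M : lmodType k) (f : T -> M) (u : freemod k T) (D : {fset T}) :
  (msupp (u : {malg k[T]}) `<=` D)%fset ->
  fm_ext f u = \sum_(x <- D) (u : {malg k[T]})@_x *: f x.
Proof.
move=> suD; rewrite /fm_ext (big_fset_incl _ suD) // => x _ xu.
by rewrite mcoeff_outdom // scale0r.
Qed.

Fact fm_ext_linear (M : lmodType k) (f : T -> M) : linear (fm_ext f).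
Proof.
move=> a u v; pose su := msupp (u : {malg k[T]}); pose sv := msupp (v : {malg k[T]}).
pose D := (msupp (a *: u + v : {malg k[T]}) `|` (su `|` sv))%fset.
rewrite !(@fm_ext_sub M f _ D); first last.
- exact: fsubsetUl.
- by apply: fsubset_trans (fsubsetUr _ _); apply: fsubsetUl.
- by apply: fsubset_trans (fsubsetUr _ _); apply: fsubsetUr.
rewrite scaler_sumr -big_split /=; apply: eq_bigr => x _.
by rewrite [in LHS]mcoeffD [X in X + _]fm_scaleE scalerDl scalerA.
Qed.
HB.instance Definition _ (M : lmodType k) (f : T -> M) :=
  GRing.isLinear.Build k (freemod k T) M *:%R (fm_ext f) (fm_ext_linear f).

Lemma fm_ext_gen (M : lmodType k) (f : T -> M) x : fm_ext f (fm_gen x) = f x.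
Proof.
rewrite (@fm_ext_sub _ _ _ [fset x]%fset); last exact: msuppU_le.
by rewrite big_seq_fset1 mcoeffU eqxx scale1r.
Qed.
End FreeModule.

Section QuotientModule.
Variables (k : pzRingType) (V : lmodType k) (S : V -> Prop).

Definition in_lspan (v : V) : Prop :=
  exists (n : nat) (c : 'I_n -> k) (w : 'I_n -> V),
    (forall i, S (w i)) /\ v = \sum_i c i *: w i.

Definition lspan : {pred V} := fun v => `[< in_lspan v >].

Lemma in_lspanZ a v : in_lspan v -> in_lspan (a *: v).
Proof.
move=> [n [c [w [Sw ->]]]]; exists n, (fun i => a * c i), w; split => //.
by rewrite scaler_sumr; apply: eq_bigr => i _; rewrite scalerA.
Qed.

Lemma in_lspanD u v : in_lspan u -> in_lspan v -> in_lspan (u + v).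
Proof.
move=> [n [c [w [Sw ->]]]] [m [d [z [Sz ->]]]]; exists (n + m)%N.
exists (fun i => match split i with inl j => c j | inr j => d j end).
exists (fun i => match split i with inl j => w j | inr j => z j end).
split=> [i|]; first by case: (split i).
rewrite big_split_ord /=; congr (_ + _); apply: eq_bigr => i _.
  by rewrite (unsplitK (inl i)).
by rewrite (unsplitK (inr i)).
Qed.

Fact lspan_zmod_closed : zmod_closed lspan.
Proof.
split=> [|u v /asboolP su /asboolP sv]; apply/asboolP.
  by exists 0%N, (fun=> 0), (fun=> 0); split=> [[]//|]; rewrite big_ord0.
by apply: in_lspanD => //; rewrite -scaleN1r; apply: in_lspanZ.
Qed.
HB.instance Definition _ := GRing.isZmodClosed.Build V lspan lspan_zmod_closed.

Definition quotmod : Type := Quotient.quot (lspan : zmodClosed V).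
HB.instance Definition _ :=
  GRing.Zmodule.copy quotmod (Quotient.quot (lspan : zmodClosed V)).

Definition qproj (v : V) : quotmod := \pi_(Quotient.quot (lspan : zmodClosed V)) v.
Definition qrepr (q : quotmod) : V := generic_quotient.repr (q : Quotient.quot (lspan : zmodClosed V)).

Lemma qreprK q : qproj (qrepr q) = q. Proof. exact: reprK. Qed.

Lemma qprojP u v : qproj u = qproj v <-> in_lspan (u - v).
Proof.
split=> [/eqP|/asboolP uv]; first by rewrite -Quotient.idealrBE => /asboolP.
by apply/eqP; rewrite -Quotient.idealrBE.
Qed.

Lemma qprojD : {morph qproj : u v / u + v}.
Proof. by move=> u v; rewrite /qproj raddfD. Qed.

Definition qscale (a : k) (q : quotmod) : quotmod := qproj (a *: qrepr q).

Lemma qscaleE a v : qscale a (qproj v) = qproj (a *: v).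
Proof. by apply/qprojP; rewrite -scalerBr; apply/in_lspanZ/qprojP/qreprK. Qed.

Fact qscaleA a b q : qscale a (qscale b q) = qscale (a * b) q.
Proof. by rewrite -(qreprK q) !qscaleE scalerA. Qed.
Fact qscale1 : left_id 1 qscale.
Proof. by move=> q; rewrite /qscale scale1r qreprK. Qed.
Fact qscaleDr : right_distributive qscale +%R.
Proof.
move=> a p q; rewrite -(qreprK p) -(qreprK q) -qprojD !qscaleE -qprojD.
by rewrite scalerDr.
Qed.
Fact qscaleDl q : {morph qscale^~ q : a b / a + b}.
Proof. by move=> a b; rewrite /qscale scalerDl qprojD. Qed.
HB.instance Definition _ := GRing.Zmodule_isLmodule.Build k quotmod
  qscaleA qscale1 qscaleDr qscaleDl.

(* For a linear f vanishing on S this is the map induced on the quotient. *)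
Definition qlift (M : Type) (f : V -> M) (q : quotmod) : M := f (qrepr q).

Lemma qliftE (M : lmodType k) (f : {linear V -> M}) v :
  (forall w, S w -> f w = 0) -> qlift f (qproj v) = f v.
Proof.
move=> f0; apply/eqP; rewrite -subr_eq0 -linearB.
have /qprojP[n [c [w [Sw ->]]]] := qreprK (qproj v).
by rewrite linear_sum big1 // => i _; rewrite linearZ f0 //= scaler0.
Qed.
End QuotientModule.

Section TensorProduct.
Variables (k : comPzRingType) (M N : lmodType k).
Let g (x : M) (y : N) : freemod k (M * N)%type := fm_gen k (x, y).

Inductive bilinear_rel : freemod k (M * N)%type -> Prop :=
| BilinDl x x' y : bilinear_rel (g (x + x') y - g x y - g x' y)
| BilinDr x y y' : bilinear_rel (g x (y + y') - g x y - g x y')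
| BilinZl a x y : bilinear_rel (g (a *: x) y - a *: g x y)
| BilinZr a x y : bilinear_rel (g x (a *: y) - a *: g x y).

Definition tensor : lmodType k := quotmod bilinear_rel.

Definition tens (x : M) (y : N) : tensor := qproj bilinear_rel (g x y).

(* For a bilinear f this is the induced linear map on the tensor product. *)
Definition tens_lift (P : lmodType k) (f : M -> N -> P) : tensor -> P :=
  qlift (fm_ext (fun xy => f xy.1 xy.2)).

Lemma tens_liftE (P : lmodType k) (f : M -> N -> P) x y :
  (forall z, linear (f z)) -> (forall z, linear (f^~ z)) ->
  tens_lift f (tens x y) = f x y.
Proof.
move=> fr fl; rewrite [LHS]qliftE /= ?fm_ext_gen // => w bw.
have frD z a b : f z (a + b) = f z a + f z b.
  by rewrite -[X in f z (X + _)]scale1r fr scale1r.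
have flD z a b : f (a + b) z = f a z + f b z.
  by rewrite -[X in f (X + _) z]scale1r fl scale1r.
have fr0 z : f z 0 = 0 by apply: (addrI (f z 0)); rewrite -frD !addr0.
have fl0 z : f 0 z = 0 by apply: (addrI (f 0 z)); rewrite -flD !addr0.
have frZ z a b : f z (a *: b) = a *: f z b by rewrite -[a *: b]addr0 fr fr0 addr0.
have flZ z a b : f (a *: b) z = a *: f b z.
  by rewrite -[a *: b]addr0 (fl z) fl0 addr0.
case: bw => *; rewrite !linearB ?linearZ /= !fm_ext_gen /=.
- by rewrite flD -addrA -opprD subrr.
- by rewrite frD -addrA -opprD subrr.
- by rewrite flZ scalerN subrr.
- by rewrite frZ scalerN subrr.
Qed.
End TensorProduct.

(** * Simplicial sets *)

Record sset := SSet {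
  splx :> nat -> Type;
  face : forall n, 'I_n.+2 -> splx n.+1 -> splx n;
  degen : forall n, 'I_n.+1 -> splx n -> splx n.+1;
  face_face : forall n (x : splx n.+2) (i j : nat), (i < j <= n.+2)%N ->
    face (inord i) (face (inord j) x) = face (inord j.-1) (face (inord i) x);
  face_degen_lt : forall n (x : splx n.+1) (i j : nat), (i < j <= n.+1)%N ->
    face (inord i) (degen (inord j) x) = degen (inord j.-1) (face (inord i) x);
  face_degen_eq : forall n (x : splx n) (j : nat), (j <= n)%N ->
    face (inord j) (degen (inord j) x) = x;
  face_degen_eqS : forall n (x : splx n) (j : nat), (j <= n)%N ->
    face (inord j.+1) (degen (inord j) x) = x;
  face_degen_gt : forall n (x : splx n.+1) (i j : nat), (j.+1 < i <= n.+2)%N ->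
    face (inord i) (degen (inord j) x) = degen (inord j) (face (inord i.-1) x);
  degen_degen : forall n (x : splx n) (i j : nat), (i <= j <= n)%N ->
    degen (inord i) (degen (inord j) x) = degen (inord j.+1) (degen (inord i) x)
}.

Section Product.
Variables X Y : sset.
Let pface n (i : 'I_n.+2) (u : X n.+1 * Y n.+1) : X n * Y n :=
  (face i u.1, face i u.2).
Let pdegen n (i : 'I_n.+1) (u : X n * Y n) : X n.+1 * Y n.+1 :=
  (degen i u.1, degen i u.2).

Fact pface_face n (u : X n.+2 * Y n.+2) (i j : nat) : (i < j <= n.+2)%N ->
  pface (inord i) (pface (inord j) u) = pface (inord j.-1) (pface (inord i) u).
Proof. by move=> ij; congr pair; exact: face_face. Qed.
Fact pface_degen_lt n (u : X n.+1 * Y n.+1) (i j : nat) : (i < j <= n.+1)%N ->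
  pface (inord i) (pdegen (inord j) u) = pdegen (inord j.-1) (pface (inord i) u).
Proof. by move=> ij; congr pair; exact: face_degen_lt. Qed.
Fact pface_degen_eq n (u : X n * Y n) (j : nat) : (j <= n)%N ->
  pface (inord j) (pdegen (inord j) u) = u.
Proof. by case: u => x y jn; congr pair; exact: face_degen_eq. Qed.
Fact pface_degen_eqS n (u : X n * Y n) (j : nat) : (j <= n)%N ->
  pface (inord j.+1) (pdegen (inord j) u) = u.
Proof. by case: u => x y jn; congr pair; exact: face_degen_eqS. Qed.
Fact pface_degen_gt n (u : X n.+1 * Y n.+1) (i j : nat) : (j.+1 < i <= n.+2)%N ->
  pface (inord i) (pdegen (inord j) u) = pdegen (inord j) (pface (inord i.-1) u).
Proof. by move=> ij; congr pair; exact: face_degen_gt. Qed.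
Fact pdegen_degen n (u : X n * Y n) (i j : nat) : (i <= j <= n)%N ->
  pdegen (inord i) (pdegen (inord j) u) = pdegen (inord j.+1) (pdegen (inord i) u).
Proof. by move=> ij; congr pair; exact: degen_degen. Qed.

Definition sprod : sset :=
  @SSet (fun n => (X n * Y n)%type) pface pdegen pface_face pface_degen_lt
    pface_degen_eq pface_degen_eqS pface_degen_gt pdegen_degen.
End Product.

(* The set of simplices of all dimensions; the dimension of u is tag u. *)
Definition simplex (X : sset) : Type := {n : nat & X n}.
Definition smk (X : sset) n (x : X n) : simplex X := Tagged X x.

(* Operators on simplices of unspecified dimension, so that iterated operators
   need no casts between X_m and X_n.  Both are only meaningful when the
   operator is defined; in the definitions below all indices are in range. *)
Definition sface (X : sset) (i : nat) (u : simplex X) : simplex X :=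
  match u with
  | existT n.+1 x => smk (face (inord i : 'I_n.+2) x)
  | existT 0 x => u
  end.

Definition sdegen (X : sset) (i : nat) (u : simplex X) : simplex X :=
  smk (degen (inord i : 'I_(tag u).+1) (tagged u)).

(* faces p r u is \partial_p \partial_{p+1} ... \partial_{r-1} u: the upper
   bound is exclusive so that \partial_0^{-1} makes sense over nat. *)
Definition faces (X : sset) (p r : nat) (u : simplex X) : simplex X :=
  foldr (fun i v => sface i v) u (iota p (r - p)).

(* s_{a_m} ... s_{a_1} u for A = {a_1 < ... < a_m}; enum A is increasing. *)
Definition degens (X : sset) n (A : {set 'I_n}) (u : simplex X) : simplex X :=
  foldl (fun v (i : 'I_n) => sdegen i v) u (enum A).

Definition degenerate (X : sset) (u : simplex X) : Prop :=
  exists n (i : 'I_n.+1) (x : X n), u = smk (degen i x).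

(** * Shuffles *)

(* A (p,q)-shuffle (alpha, beta) is given by alpha : {set 'I_(p + q)} with
   #|alpha| = p, and beta = ~: alpha. *)
Section ShufflePerm.
Variables (n : nat) (A : {set 'I_n}).
Definition shuffle_fun (i : 'I_n) : 'I_n := nth i (enum A ++ enum (~: A)) i.

Fact shuffle_fun_inj : injective shuffle_fun.
Proof.
have sz : size (enum A ++ enum (~: A)) = n.
  by rewrite size_cat -!cardE cardsC card_ord.
have un : uniq (enum A ++ enum (~: A)).
  rewrite cat_uniq !enum_uniq andbT /= -all_predC; apply/allP => x /=.
  by rewrite !mem_enum inE.
move=> i j; rewrite /shuffle_fun (set_nth_default i j) ?sz // => /eqP.
by rewrite nth_uniq ?sz // => /eqP /val_inj.
Qed.

(* (alpha_1 < ... < alpha_p, beta_1 < ... < beta_q) in one-line notation *)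
Definition shuffle_perm : {perm 'I_n} := perm shuffle_fun_inj.
End ShufflePerm.

(** * The normalized chain complex and the Eilenberg-Zilber maps *)

Section Chains.
Variable k : comPzRingType.

(* As the identities do not involve the differential, C X is only given as a
   module: the direct sum over all n of the free modules on X_n, modulo
   degenerate simplices. *)
Definition schain (X : sset) : lmodType k := freemod k {classic simplex X}.

Definition sgen (X : sset) (u : simplex X) : schain X :=
  fm_gen k (u : {classic simplex X}).

Definition degenerate_chain (X : sset) (c : schain X) : Prop :=
  exists2 u, degenerate u & c = sgen u.

Definition C (X : sset) : lmodType k := quotmod (@degenerate_chain X).

Definition cls (X : sset) (u : simplex X) : C X := qproj _ (sgen u).

(* The linear map out of C X with the given values on simplices.  It is well
   defined when f maps degenerate simplices to 0, as is the case in all uses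
   below. *)
Definition Cext (X : sset) (M : lmodType k) (f : simplex X -> M) : C X -> M :=
  qlift (fm_ext (f : {classic simplex X} -> M)).

Lemma Cext_cls (X : sset) (M : lmodType k) (f : simplex X -> M) (u : simplex X) :
  (forall v, degenerate v -> f v = 0) -> Cext f (cls u) = f u.
Proof.
by move=> f0; rewrite [LHS]qliftE /= ?fm_ext_gen // => _ [v vd ->]; rewrite fm_ext_gen f0.
Qed.

(* The class of the simplex (u, v) of X * Y; u and v have the same dimension
   wherever this is used, and 0 is a dummy value otherwise. *)
Definition cpair (X Y : sset) (u : simplex X) (v : simplex Y) : C (sprod X Y) :=
  untag 0 (fun y : Y (tag u) => cls (@smk (sprod X Y) (tag u) (tagged u, y))) v.

Definition sfst (X Y : sset) (u : simplex (sprod X Y)) : simplex X :=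
  smk (tagged u).1.
Definition ssnd (X Y : sset) (u : simplex (sprod X Y)) : simplex Y :=
  smk (tagged u).2.

Section TwoFactors.
Variables X Y : sset.

Definition AW : C (sprod X Y) -> tensor (C X) (C Y) :=
  Cext (fun u => let n := tag u in
    \sum_(i < n.+1)
      tens (cls (faces i.+1 n.+1 (sfst u))) (cls (faces 0 i (ssnd u)))).

Definition nabla_splx (x : simplex X) (y : simplex Y) : C (sprod X Y) :=
  let p := tag x in let q := tag y in
  \sum_(A : {set 'I_(p + q)} | #|A| == p)
    (-1) ^+ odd_perm (shuffle_perm A) *: cpair (degens (~: A) x) (degens A y).

Definition nabla : tensor (C X) (C Y) -> C (sprod X Y) :=
  tens_lift (fun c d => Cext (fun x => Cext (fun y => nabla_splx x y) d) c).

Definition F (c : C (sprod X Y)) : C (sprod X Y) := nabla (AW c).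

Definition tildeH : C (sprod X Y) -> C (sprod X Y) :=
  Cext (fun u => let n := tag u in
    \sum_(p < n) \sum_(q < n | (p + q < n)%N)
      \sum_(A : {set 'I_(p + q.+1)} | #|A| == p)
        (-1) ^+ (p + q + odd_perm (shuffle_perm A)) *:
          cpair (degens (~: A) (faces p.+1 (p + q).+1 (sfst u)))
                (sdegen (p + q).+1 (degens A (faces 0 p (ssnd u))))).
End TwoFactors.

Section ThreeFactors.
Variables X Y Z : sset.

Definition sassoc (u : simplex (sprod (sprod X Y) Z)) :
    simplex (sprod X (sprod Y Z)) :=
  @smk (sprod X (sprod Y Z)) (tag u)
    ((tagged u).1.1, ((tagged u).1.2, (tagged u).2)).

Definition sunassoc (u : simplex (sprod X (sprod Y Z))) :
    simplex (sprod (sprod X Y) Z) :=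
  @smk (sprod (sprod X Y) Z) (tag u)
    (((tagged u).1, (tagged u).2.1), (tagged u).2.2).

(* An endomap of C (X * (Y * Z)) seen as an endomap of C ((X * Y) * Z). *)
Definition reassoc (f : C (sprod X (sprod Y Z)) -> C (sprod X (sprod Y Z)))
    (c : C (sprod (sprod X Y) Z)) : C (sprod (sprod X Y) Z) :=
  Cext (fun u => cls (sunassoc u)) (f (Cext (fun u => cls (sassoc u)) c)).

Definition F_XY_Z : C (sprod (sprod X Y) Z) -> C (sprod (sprod X Y) Z) :=
  @F (sprod X Y) Z.
Definition F_X_YZ : C (sprod (sprod X Y) Z) -> C (sprod (sprod X Y) Z) :=
  reassoc (@F X (sprod Y Z)).
Definition tildeH_XY_Z : C (sprod (sprod X Y) Z) -> C (sprod (sprod X Y) Z) :=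
  @tildeH (sprod X Y) Z.
Definition tildeH_X_YZ : C (sprod (sprod X Y) Z) -> C (sprod (sprod X Y) Z) :=
  reassoc (@tildeH X (sprod Y Z)).
End ThreeFactors.
End Chains.

(* Main.v *)
From HB Require Import structures.
Require Import Defs.
From mathcomp Require Import all_boot all_algebra.
From mathcomp Require Import all_fingroup finmap monalg zify.

Set Implicit Arguments.
Unset Strict Implicit.
Unset Printing Implicit Defensive.

Import GRing.Theory.
Local Open Scope ring_scope.

(** Why the identities hold.

    Let x, y, z be simplices of dimension n of X, Y, Z.  A simplex of X * Y * Z
    built from them by faces and degeneracies in each factor is a weakly
    increasing sequence w_0, ..., w_l of vertices of the grid [n]^3; it is
    degenerate when two consecutive vertices agree, and (x, y, z) itself is the
    diagonal sequence.  In this picture, for a product of two factors A * B,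

      F(w)  = sum over p of the lattice paths that shuffle the A-coordinates of
              w_0 ... w_p with the B-coordinates of w_p ... w_l,
      H~(w) = - sum over m of (-1)^m F(w_0 ... w_m) * (w_m ... w_l),

    where * between sequences is juxtaposition.  The summand (p, q) of the definition of H~
    is the cut p of the part m = p + q + 1 of this formula: its path ends with
    the A-coordinate of w_p and the B-coordinate of w_m and then jumps to w_m.
    The remaining parts, those with p = m, repeat w_m and vanish.

    First two identities.  F is a cut (the map AW) followed by a shuffle (the
    map nabla), and H~ commutes with each of the two steps separately, up to a
    sign that cancels: HpathZ_cutsum and shsum_HpathZ for H~_(XY,Z) against
    F_(X,YZ), HpathX_cutsum and shsum_HpathX for H~_(X,YZ) against F_(XY,Z).
    These rest on three facts about sequences: cuts are coassociative
    (cutsum_coassoc), shuffles are associative (shsum_assoc), and cutting a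
    shuffle is shuffling the pieces of two cuts (shsum_cut).  After rewriting
    with them both sides have the same nondegenerate terms: a step in one
    coordinate is invisible in the others, so that any cut which puts it on the
    wrong side of the tensor product, or of a second shuffle, leaves a
    repetition.

    Third identity.  It follows formally from the first two (Hpath_Hpath and
    Hpath_anticomm).  Apply H~' to a term F(w_0 ... w_m) * (w_m ... w_l) of
    H~(w).  Either H~' acts inside the first factor, or it reaches into the
    second one, and then the terms with the same end point r add up, apart from
    the sign, to F'(H~(w_0 ... w_r)) * (w_r ... w_l).  Exchanging the roles of
    H~ and H~' turns the two families into each other because F and H~' commute,
    as do F' and H~, and the signs are opposite.

    Sums of sequences are handled dually: a map of chains is represented by its
    action f |-> (w |-> value of f on the image of w) on functions f of a
    sequence with values in a module, so composition is reversed.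

    Passage to simplices.  The simplex with vertices l of a given simplex u is
    act l u; repeating or deleting a vertex of l is a degeneracy or a face
    (sdegen_act, sface_act).  The shuffles given by subsets are matched with
    lattice paths by splitting off the first step (subset_shsumS,
    shsum_subset_shsum), which yields the formulas above for F and H~
    (F_path_chain, tildeH_path_chain).  The same formulas show that all maps
    kill degenerate simplices, hence are linear and determined by their values
    on simplices. *)

(** * Sums over cuts and shuffles of vertex sequences *)

(** Closes equalities of signs: two signs agree when their exponents have the same
    parity, and for sums and products this is a finite check. *)
Ltac parity :=
  rewrite ?(oddD, oddM, oddS) /=;
  repeat match goal with |- context [odd ?n] => case: (odd n) end; done.

Section Cut.
Variables (V : eqType) (M : zmodType).
Implicit Types (g : seq V -> seq V -> M) (u v w : seq V).

(** The two parts of a cut share a vertex: this is the front face / back face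
    diagonal, evaluated on a function g of two sequences. *)
Definition cutsum g w : M := \sum_(i < size w) g (take i.+1 w) (drop i w).

Lemma cutsum_nil g : cutsum g [::] = 0. Proof. exact: big_ord0. Qed.

Lemma cutsum_cons g a w :
  cutsum g (a :: w) = g [:: a] (a :: w) + cutsum (fun u v => g (a :: u) v) w.
Proof. by rewrite /cutsum big_ord_recl /= take0. Qed.

Lemma eq_cutsum g g' w :
  (forall u x v, w = u ++ x :: v -> g (rcons u x) (x :: v) = g' (rcons u x) (x :: v)) ->
  cutsum g w = cutsum g' w.
Proof.
elim: w g g' => [|a w IHw] g g' eg; first by rewrite !cutsum_nil.
rewrite !cutsum_cons (eg [::]) //; congr (_ + _); apply: IHw => u x v ew.
by rewrite -!rcons_cons; apply: eg; rewrite ew.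
Qed.

Lemma cutsum_add g g' w : cutsum (fun u v => g u v + g' u v) w = cutsum g w + cutsum g' w.
Proof. exact: big_split. Qed.

Lemma cutsum_exchange (G : seq V -> seq V -> seq V -> seq V -> M) w w' :
  cutsum (fun u v => cutsum (G u v) w') w =
  cutsum (fun u' v' => cutsum (fun u v => G u v u' v') w) w'.
Proof. exact: exchange_big. Qed.

(** Both sides sum over the pairs of cuts of w at positions i <= j. *)
Lemma cutsum_coassoc (G : seq V -> seq V -> seq V -> M) w :
  cutsum (fun u v => cutsum (fun u1 u2 => G u1 u2 v) u) w =
  cutsum (fun u v => cutsum (fun v1 v2 => G u v1 v2) v) w.
Proof.
elim: w G => [|a w IHw] G; first by rewrite !cutsum_nil.
rewrite !cutsum_cons !cutsum_nil addr0 -IHw -addrA; congr (_ + _); rewrite -cutsum_add.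
by apply: eq_cutsum => u x v _; rewrite cutsum_cons.
Qed.

(** The junction of u and v joins two positions, so a cut lies in u or in v. *)
Lemma cutsum_cat g u v : cutsum g (u ++ v) =
  cutsum (fun u1 u2 => g u1 (u2 ++ v)) u + cutsum (fun v1 v2 => g (u ++ v1) v2) v.
Proof.
elim: u g => [|a u IHu] g /=; first by rewrite cutsum_nil add0r.
by rewrite !cutsum_cons IHu addrA.
Qed.

(** The situation in which g is normalized in its first argument for a coordinate
    along which the sequence is constant: only the cut at the first vertex is left. *)
Lemma cutsum_head g a w :
  (forall b c u v, g [:: b, c & u] v = 0) -> cutsum g (a :: w) = g [:: a] (a :: w).
Proof.
move=> g0; rewrite cutsum_cons -[RHS]addr0; congr (_ + _); rewrite /cutsum big1 // => i _.
by case: w i => [|b w] i; [case: i | rewrite /= g0].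
Qed.

Lemma cutsum_last g w a :
  (forall u b c v, g u [:: b, c & v] = 0) -> cutsum g (rcons w a) = g (rcons w a) [:: a].
Proof.
elim: w g => [|b w IHw] g g0 /=; first by rewrite cutsum_cons cutsum_nil addr0.
rewrite cutsum_cons IHw //; case: w IHw => [|c w] _; by rewrite g0 add0r.
Qed.
End Cut.

Lemma cutsum_scale (V : eqType) (k : pzRingType) (M : lmodType k) (c : k)
    (g : seq V -> seq V -> M) w :
  cutsum (fun u v => c *: g u v) w = c *: cutsum g w.
Proof. by rewrite /cutsum scaler_sumr. Qed.

Section Shuffle.
Variables (V : eqType) (m : V -> V -> V).

(** The lattice paths from (a_0, b_0) to the last vertices of a and b; a path visits
    the vertices m a_i b_j, and its sign has the given exponent.  A step in b that
    comes first has to pass all the remaining steps in a.  Without any vertex in a or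
    b there is no path; this makes one of the two recursive calls vanish at the
    boundary of the grid. *)
Fixpoint shuffles (a : seq V) : seq V -> seq (nat * seq V) :=
  if a is a0 :: a' then
    fix shufa (b : seq V) : seq (nat * seq V) :=
      if b is b0 :: b' then
        if nilp a' && nilp b' then [:: (0%N, [:: m a0 b0])] else
        [seq (p.1, m a0 b0 :: p.2) | p <- shuffles a' b] ++
        [seq ((size a' + p.1)%N, m a0 b0 :: p.2) | p <- shufa b']
      else [::]
  else fun=> [::].

Lemma shuffles0 a : shuffles a [::] = [::]. Proof. by case: a. Qed.

Lemma shufflesP a0 a b0 b p : p \in shuffles (a0 :: a) (b0 :: b) ->
  exists w, [/\ p.2 = m a0 b0 :: w, size w = (size a + size b)%N &
    last (m a0 b0) w = m (last a0 a) (last b0 b)].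
Proof.
elim: a a0 b0 b p => [|a1 a IHa] a0 b0 b p.
  elim: b b0 p => [|b1 b IHb] b0 p.
    by rewrite /= inE => /eqP->; exists [::].
  rewrite [shuffles _ _]/= => /mapP[q /IHb[w [q2 sw lw]] -> /=]; rewrite q2.
  by exists (m a0 b1 :: w); rewrite /= sw.
elim: b b0 p => [|b1 b IHb] b0 p.
  rewrite /= cats0 => /mapP[q /IHa[w [q2 sw lw]] -> /=]; rewrite q2.
  by exists (m a1 b0 :: w); rewrite /= sw.
rewrite [shuffles _ _]/= mem_cat => /orP[] /mapP[q].
  move=> /IHa[w [q2 sw lw]] -> /=; rewrite q2.
  by exists (m a1 b0 :: w); rewrite /= sw.
move=> /IHb[w [q2 sw lw]] -> /=; rewrite q2.
by exists (m a0 b1 :: w); rewrite /= sw; split => //; rewrite addnS.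
Qed.

Variables (k : pzRingType) (M : lmodType k).
Implicit Types (f : seq V -> M).

(** The shuffle map in dual form: the value of f on the shuffle product of a and b. *)
Definition shsum f (a b : seq V) : M := \sum_(p <- shuffles a b) (-1) ^+ p.1 *: f p.2.

Lemma shsum0l f b : shsum f [::] b = 0. Proof. by rewrite /shsum big_nil. Qed.
Lemma shsum0r f a : shsum f a [::] = 0. Proof. by rewrite /shsum shuffles0 big_nil. Qed.

Lemma shsum_cons f a0 a b0 b : shsum f (a0 :: a) (b0 :: b) =
  (if nilp a && nilp b then f [:: m a0 b0] else 0) +
  shsum (fun w => f (m a0 b0 :: w)) a (b0 :: b) +
  (-1) ^+ size a *: shsum (fun w => f (m a0 b0 :: w)) (a0 :: a) b.
Proof.
rewrite {1}/shsum /=; case: ifP => [/andP[/nilP-> /nilP->]|_].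
  by rewrite shsum0l shsum0r scaler0 !addr0 big_seq1 scale1r.
rewrite big_cat !big_map add0r; congr (_ + _).
by rewrite scaler_sumr; apply: eq_bigr => p _ /=; rewrite exprD scalerA.
Qed.

Lemma eq_shsum f g a0 a b0 b :
  (forall w, size w = (size a + size b)%N -> last (m a0 b0) w = m (last a0 a) (last b0 b) ->
     f (m a0 b0 :: w) = g (m a0 b0 :: w)) ->
  shsum f (a0 :: a) (b0 :: b) = shsum g (a0 :: a) (b0 :: b).
Proof.
move=> fg; rewrite /shsum !big_seq; apply: eq_bigr => p /shufflesP[w [-> sw lw]].
by rewrite fg.
Qed.

Lemma eq_shsum_fun f g a b : f =1 g -> shsum f a b = shsum g a b.
Proof. by move=> fg; apply: eq_bigr => p _; rewrite fg. Qed.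

Lemma shsum_eq0 f a b : (forall w, f w = 0) -> shsum f a b = 0.
Proof. by move=> f0; rewrite /shsum big1 // => p _; rewrite f0 scaler0. Qed.

Lemma shsum_add f g a b : shsum (fun w => f w + g w) a b = shsum f a b + shsum g a b.
Proof. by rewrite /shsum -big_split; apply: eq_bigr => p _; rewrite scalerDr. Qed.

End Shuffle.
Arguments shsum {V} m {k M}.

Section ShuffleAlgebra.
Variables (k : comPzRingType) (M : lmodType k) (V : eqType).
Implicit Types (f : seq V -> M) (m : V -> V -> V).

Lemma shsum_scale m (c : k) f a b : shsum m (fun w => c *: f w) a b = c *: shsum m f a b.
Proof.
rewrite /shsum scaler_sumr; apply: eq_bigr => p _.
by rewrite !scalerA mulrC.
Qed.

Lemma shsum_cut_exchange m (G : seq V -> seq V -> seq V -> M) a b w :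
  shsum m (fun t => cutsum (fun u v => G u v t) w) a b = cutsum (fun u v => shsum m (G u v) a b) w.
Proof.
rewrite /shsum /cutsum exchange_big; apply: eq_bigr => p _ /=.
by rewrite scaler_sumr.
Qed.

Lemma shsum_exchange m m' (G : seq V -> seq V -> M) a b a' b' :
  shsum m (fun t => shsum m' (G t) a' b') a b =
  shsum m' (fun t' => shsum m (fun t => G t t') a b) a' b'.
Proof.
rewrite /shsum; under eq_bigr do rewrite scaler_sumr.
rewrite exchange_big; apply: eq_bigr => p _ /=; rewrite scaler_sumr.
by apply: eq_bigr => q _; rewrite !scalerA mulrC.
Qed.

Lemma shsum1r m f a b0 : shsum m f a [:: b0] = if a is a0 :: a' then f (map (m^~ b0) a) else 0.
Proof.
case: a => [|a0 a]; first exact: shsum0l.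
elim: a a0 f => [|a1 a IHa] a0 f; rewrite shsum_cons shsum0r scaler0 addr0 /=.
  by rewrite shsum0l addr0.
by rewrite add0r IHa.
Qed.

Lemma shsum1l m f a0 b : shsum m f [:: a0] b = if b is b0 :: b' then f (map (m a0) b) else 0.
Proof.
case: b => [|b0 b]; first exact: shsum0r.
elim: b b0 f => [|b1 b IHb] b0 f; rewrite shsum_cons shsum0l addr0 /=.
  by rewrite shsum0r scaler0 addr0.
by rewrite add0r IHb scale1r.
Qed.

Lemma signE (i j : nat) : odd i = odd j -> (-1) ^+ i = (-1) ^+ j :> k.
Proof. by move=> ij; rewrite -[LHS]signr_odd ij signr_odd. Qed.

(** A path that is cut at the vertex (a_i, b_j) is a path over the cuts of a at i and
    of b at j.  The sign comes from the steps of the front part of b, which pass the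
    steps of the back part of a. *)
Lemma shsum_cut m (G : seq V -> seq V -> M) a b :
  shsum m (cutsum G) a b =
  cutsum (fun a1 a2 => cutsum (fun b1 b2 =>
    (-1) ^+ ((size b1).-1 * (size a2).-1) *: shsum m (fun w1 => shsum m (G w1) a2 b2) a1 b1) b) a.
Proof.
elim: a b G => [|a0 a IHa] b G; first by rewrite shsum0l cutsum_nil.
elim: b G => [|b0 b IHb] G.
  by rewrite shsum0r /cutsum big1 // => i _; rewrite big_ord0.
set x := m a0 b0.
pose Gx u v := G (x :: u) v.
have -> : shsum m (cutsum G) (a0 :: a) (b0 :: b) =
    shsum m (G [:: x]) (a0 :: a) (b0 :: b) + shsum m (cutsum Gx) a (b0 :: b)
    + (-1) ^+ size a *: shsum m (cutsum Gx) (a0 :: a) b.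
  rewrite !shsum_cons -/x.
  under eq_shsum_fun do rewrite cutsum_cons.
  under [X in _ + _ *: X = _]eq_shsum_fun do rewrite cutsum_cons.
  rewrite !shsum_add scalerDr cutsum_cons cutsum_nil addr0 -/Gx.
  rewrite -!addrA; congr (_ + _); rewrite !addrA; congr (_ + _).
  by rewrite -!addrA; congr (_ + _); rewrite addrC.
rewrite IHa IHb !cutsum_cons -!addrA; congr (_ + _).
  by rewrite mul0n scale1r shsum1r.
have -> : cutsum (fun u v => (-1) ^+ ((size (b0 :: u)).-1 * (size (a0 :: a)).-1) *:
      shsum m (fun w1 => shsum m (G w1) (a0 :: a) v) [:: a0] (b0 :: u)) b =
    (-1) ^+ size a *: cutsum (fun u v => (-1) ^+ ((size u).-1 * (size (a0 :: a)).-1) *: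
      shsum m (fun w1 => shsum m (Gx w1) (a0 :: a) v) [:: a0] u) b.
  rewrite -cutsum_scale; apply: eq_cutsum => u y v _; rewrite scalerA -exprD.
  rewrite shsum_cons shsum0l /nilp ?size_rcons /= !add0r expr0 scale1r.
  by rewrite ?size_rcons mulSn.
rewrite scalerDr addrCA; congr (_ + _).
rewrite -cutsum_scale -cutsum_add.
apply: eq_cutsum => a1 y a2 ea; rewrite !cutsum_cons -!addrA; congr (_ + _).
  rewrite !mul0n !expr0 !scale1r shsum_cons shsum0r scaler0 addr0.
  by rewrite /nilp ?size_rcons /= add0r.
rewrite -cutsum_scale -!cutsum_add; apply: eq_cutsum => b1 z b2 eb.
rewrite [in RHS]shsum_cons /nilp ?size_rcons /= add0r scalerDr; congr (_ + _).
rewrite !scalerA -!exprD; congr (_ *: _); apply: signE.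
by rewrite ea ?size_rcons size_cat /=; parity.
Qed.

(** A path over b ++ c crosses from b to c in a single step; the vertex of a at which
    this happens cuts a, and the path splits into two independent ones.  The crossing
    is one more step in the second direction, which the sign takes into account. *)
Lemma shsum_catr m f a b0 b c0 c :
  shsum m f a ((b0 :: b) ++ c0 :: c) =
  cutsum (fun a1 a2 => (-1) ^+ ((size b).+1 * (size a2).-1) *:
    shsum m (fun w1 => shsum m (fun w2 => f (w1 ++ w2)) a2 (c0 :: c)) a1 (b0 :: b)) a.
Proof.
elim: a b0 b f => [|a0 a IHa] b0 b f; first by rewrite shsum0l cutsum_nil.
elim: b b0 f => [|b1 b IHb] b0 f; rewrite !cat_cons shsum_cons cutsum_cons.
  rewrite cat0s {1}/nilp /= andbF add0r shsum1r /= mul1n addrC; congr (_ + _).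
  rewrite -cat1s IHa; apply: eq_cutsum => a1 y a2 _; congr (_ *: _).
  rewrite [RHS]shsum_cons shsum0r scaler0 addr0 /nilp ?size_rcons /= add0r.
  by apply: eq_shsum_fun => w1; apply: eq_shsum_fun.
rewrite {1}/nilp /= andbF add0r -!cat_cons IHa IHb cutsum_cons scalerDr addrCA.
congr (_ + _).
  rewrite [in RHS]shsum_cons shsum0l /nilp /= add0r add0r scale1r scalerA -exprD.
  congr (_ *: _); apply: signE; by parity.
rewrite -cutsum_scale -cutsum_add; apply: eq_cutsum => a1 y a2 ea.
rewrite [in RHS]shsum_cons /nilp ?size_rcons /= add0r scalerDr !scalerA -!exprD.
congr (_ *: _ + _ *: _); apply: signE.
by rewrite ea ?size_rcons size_cat /=; parity.
Qed.

(** As for shsum_catr; here the crossing is one more step in the first direction, and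
    the steps of the front part of b pass it. *)
Lemma shsum_catl m f a0 a c0 c b :
  shsum m f ((a0 :: a) ++ c0 :: c) b =
  cutsum (fun b1 b2 => (-1) ^+ ((size b1).-1 * (size c).+1) *:
    shsum m (fun w1 => shsum m (fun w2 => f (w1 ++ w2)) (c0 :: c) b2) (a0 :: a) b1) b.
Proof.
elim: a a0 b f => [|a1 a IHa] a0 b f.
  elim: b f => [|b0 b IHb] f; first by rewrite shsum0r cutsum_nil.
  rewrite !cat_cons cat0s shsum_cons cutsum_cons -[a0 :: _]cat1s IHb.
  rewrite {1}/nilp /= add0r shsum1r mul0n scale1r; congr (_ + _).
  rewrite -cutsum_scale; apply: eq_cutsum => b1 y b2 _.
  rewrite [in RHS]shsum_cons shsum0l /nilp ?size_rcons /= !add0r scale1r scalerA -exprD.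
  by congr (_ *: _); apply: signE; parity.
elim: b f => [|b0 b IHb] f; first by rewrite shsum0r cutsum_nil.
rewrite !cat_cons shsum_cons -!cat_cons IHa IHb !cutsum_cons.
rewrite {1}/nilp /= add0r -addrA; congr (_ + _).
  rewrite [in RHS]shsum_cons shsum0r scaler0 addr0 /nilp /= add0r !mul0n !scale1r.
  by [].
rewrite -cutsum_scale -cutsum_add; apply: eq_cutsum => b1 y b2 eb.
rewrite [in RHS]shsum_cons /nilp ?size_rcons /= add0r scalerDr !scalerA -!exprD.
congr (_ *: _ + _ *: _); apply: signE.
by rewrite size_cat /=; parity.
Qed.

Lemma eq_shsum_size m f g a b :
  (forall x w, (size w).+2 = (size a + size b)%N -> f (x :: w) = g (x :: w)) ->
  shsum m f a b = shsum m g a b.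
Proof.
case: a b => [|a0 a] [|b0 b] fg; rewrite ?shsum0l ?shsum0r //.
by apply: eq_shsum => w sw _; apply: fg; rewrite /= sw addnS.
Qed.

(** Both sides sum over the lattice paths in the box with sides a, b, c.  The first
    step of such a path is in one of three directions, and both sides satisfy the
    resulting recursion (expandL and expandR). *)
Lemma shsum_assoc mixX mixZ f a b c :
  (forall x y z, mixZ (mixX x y) z = mixX x (mixZ y z)) ->
  shsum mixX (fun w => shsum mixZ f w c) a b = shsum mixZ (fun w => shsum mixX f a w) b c.
Proof.
move=> mixXZ.
elim: a b c f => [|a0 a IHa] b c f.
  by rewrite shsum0l shsum_eq0 // => w; rewrite shsum0l.
elim: b c f => [|b0 b IHb] c f; first by rewrite shsum0l shsum0r.
elim: c f => [|c0 c IHc] f.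
  by rewrite shsum0r shsum_eq0 // => w; rewrite shsum0r.
pose f' w := f (mixX a0 (mixZ b0 c0) :: w).
pose d : M := if [&& nilp a, nilp b & nilp c] then f [:: mixX a0 (mixZ b0 c0)] else 0.
have expandL : shsum mixX (fun w => shsum mixZ f w (c0 :: c)) (a0 :: a) (b0 :: b) =
    d + shsum mixX (fun w => shsum mixZ f' w (c0 :: c)) a (b0 :: b)
    + (-1) ^+ size a *: shsum mixX (fun w => shsum mixZ f' w (c0 :: c)) (a0 :: a) b
    + (-1) ^+ (size a + size b) *: shsum mixX (fun w => shsum mixZ f' w c) (a0 :: a) (b0 :: b).
  have E a' b' : (size a' + size b' = (size a + size b).+1)%N ->
      shsum mixX (fun w => shsum mixZ f (mixX a0 b0 :: w) (c0 :: c)) a' b' =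
      shsum mixX (fun w => shsum mixZ f' w (c0 :: c)) a' b' +
      (-1) ^+ (size a + size b) *: shsum mixX (fun w => shsum mixZ f' (mixX a0 b0 :: w) c) a' b'.
    move=> sab; rewrite -shsum_scale -shsum_add; apply: eq_shsum_size => y w.
    by rewrite sab => -[sw]; rewrite shsum_cons /nilp /= add0r mixXZ sw.
  rewrite shsum_cons !E /=; try by rewrite ?addnS.
  rewrite [in RHS]shsum_cons [X in (if _ then X else _) + _ + _ = _]shsum_cons.
  rewrite shsum0l addr0 mixXZ -/f' /= scale1r.
  have -> : (if nilp a && nilp b then
      (if nilp c then f [:: mixX a0 (mixZ b0 c0)] else 0) +
      shsum mixZ f' [:: mixX a0 b0] c else 0) =
      d + (-1) ^+ (size a + size b) *:
        (if nilp a && nilp b then shsum mixZ f' [:: mixX a0 b0] c else 0).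
    rewrite /d; case: nilP => [->|_] /=; last by rewrite scaler0 addr0.
    by case: nilP => [->|_] /=; rewrite ?scale1r ?scaler0 ?addr0.
  rewrite !scalerDr !scalerA -!exprD -!addrA; congr (_ + _).
  rewrite addrCA; congr (_ + _); rewrite [RHS]addrCA; congr (_ + _).
  by rewrite addrCA; congr (_ + (_ + _ *: _)); apply: signE; parity.
have expandR : shsum mixZ (fun w => shsum mixX f (a0 :: a) w) (b0 :: b) (c0 :: c) =
    d + shsum mixZ (fun w => shsum mixX f' a w) (b0 :: b) (c0 :: c)
    + (-1) ^+ size a *: shsum mixZ (fun w => shsum mixX f' (a0 :: a) w) b (c0 :: c)
    + (-1) ^+ (size a + size b) *: shsum mixZ (fun w => shsum mixX f' (a0 :: a) w) (b0 :: b) c.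
  have E b' c' :
      shsum mixZ (fun w => shsum mixX f (a0 :: a) (mixZ b0 c0 :: w)) b' c' =
      shsum mixZ (fun w => shsum mixX f' a (mixZ b0 c0 :: w)) b' c' +
      (-1) ^+ size a *: shsum mixZ (fun w => shsum mixX f' (a0 :: a) w) b' c'.
    rewrite -shsum_scale -shsum_add; apply: eq_shsum_size => y w _.
    by rewrite shsum_cons /nilp /= andbF add0r.
  rewrite shsum_cons !E /= shsum_cons shsum0r scaler0 addr0 -/f' {1}/nilp /= andbT.
  rewrite [X in _ = _ + X + _ + _]shsum_cons.
  have -> : (if nilp b && nilp c then
      (if nilp a then f [:: mixX a0 (mixZ b0 c0)] else 0) +
      shsum mixX f' a [:: mixZ b0 c0] else 0) =
      d + (if nilp b && nilp c then shsum mixX f' a [:: mixZ b0 c0] else 0).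
    rewrite /d andbC; case: nilP => //= _; last by rewrite andbF addr0.
    by case: (nilp b); rewrite ?andbF ?andbT ?addr0.
  rewrite !scalerDr !scalerA -!exprD -!addrA; do 3![congr (_ + _)].
  rewrite addrCA; congr (_ + (_ + _ *: _)).
  by apply: signE; parity.
by rewrite expandL expandR IHa IHb IHc.
Qed.

Lemma shsum_mapl m (K : eqType) (q : V -> K) f a a' b :
  (forall x x' y, q x = q x' -> m x y = m x' y) ->
  map q a = map q a' -> shsum m f a b = shsum m f a' b.
Proof.
move=> qm; elim: a a' b f => [|x a IHa] [|x' a'] b f //= [qx qa].
elim: b f => [|y b IHb] f; first by rewrite !shsum0r.
rewrite !shsum_cons (qm _ _ _ qx) IHb (IHa _ _ _ qa); congr (_ + _ + _ *: _).
  by rewrite /nilp -(size_map q a) qa size_map.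
by rewrite -(size_map q a) qa size_map.
Qed.

Lemma shsum_mapr m (K : eqType) (q : V -> K) f a b b' :
  (forall x y y', q y = q y' -> m x y = m x y') ->
  map q b = map q b' -> shsum m f a b = shsum m f a b'.
Proof.
move=> qm; elim: a b b' f => [|x a IHa] b b' f; first by rewrite !shsum0l.
elim: b b' f => [|y b IHb] [|y' b'] f //= [qy qb].
rewrite !shsum_cons (qm _ _ _ qy) (IHb b') // (IHa _ (y' :: b')) /= ?qy ?qb //.
congr (_ + _ + _ *: _).
by rewrite /nilp -(size_map q b) qb size_map.
Qed.

Section Repetition.
Variables (K : eqType) (q : V -> K).

(** With a coordinate q this detects a degeneracy in that factor, with the identity
    a degeneracy of the whole simplex. *)
Fixpoint stutters (w : seq V) : bool :=
  if w is x :: w' then (if w' is y :: _ then q x == q y else false) || stutters w' else false.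

Lemma stutters_cons x w : stutters w -> stutters (x :: w).
Proof. by move=> rw; rewrite /= rw orbT. Qed.

Lemma stutters_catl u v : stutters u -> stutters (u ++ v).
Proof.
by elim: u => [|x [|y u] IHu] //= /orP[->|/IHu /= ->] //; rewrite orbT.
Qed.

Lemma stutters_join u x y v : q x = q y -> stutters (rcons u x ++ y :: v).
Proof.
move=> xy; elim: u => [|z u IHu] /=; first by rewrite xy eqxx.
by rewrite IHu orbT.
Qed.

Lemma stutters_catr u v : stutters v -> stutters (u ++ v).
Proof. by elim: u => //= x u IHu /IHu->; rewrite orbT. Qed.

Lemma stutters_split u x v :
  stutters (u ++ x :: v) = stutters (rcons u x) || stutters (x :: v).
Proof.
elim: u => [|y u IHu] //=; rewrite IHu orbA; congr (_ || _ || _).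
by case: u {IHu}.
Qed.

Lemma stuttersP w : stutters w ->
  exists u x y v, w = u ++ [:: x, y & v] /\ q x = q y.
Proof.
elim: w => [//|x [|y w] IHw] //= /orP[/eqP qxy|]; first by exists [::], x, y, w.
by move=> /IHw[u [x' [y' [v [-> e]]]]]; exists (x :: u), x', y', v.
Qed.

Definition normalized f := forall w, stutters w -> f w = 0.

Lemma normalized_cons f x : normalized f -> normalized (fun w => f (x :: w)).
Proof. by move=> nf w rw; apply/nf/stutters_cons. Qed.
End Repetition.

(** A step of a that q' does not see yields a step of every path that q does not see.
    With a constant q' this applies to every a of positive dimension, as soon as q
    ignores the first argument of m. *)
Lemma shsum_stutterl m (K K' : eqType) (q : V -> K) (q' : V -> K') f a b :
  (forall x x' y, q' x = q' x' -> q (m x y) = q (m x' y)) ->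
  normalized q f -> stutters q' a -> shsum m f a b = 0.
Proof.
move=> qm; elim: a b f => [//|x a IHa] b f nf ra.
elim: b f nf => [|y b IHb] f nf; first by rewrite shsum0r.
rewrite shsum_cons IHb ?scaler0 ?addr0; last exact: normalized_cons.
case: a IHa ra {IHb} => [//|x' a] IHa /= /orP[/eqP xx'|ra]; last first.
  by rewrite add0r IHa //; apply: normalized_cons.
rewrite add0r (@eq_shsum _ _ _ _ _ (fun=> 0)) ?shsum_eq0 // => w _ _.
by apply: nf; rewrite /= (qm _ _ _ xx') eqxx.
Qed.

Lemma shsum_stutterr m (K K' : eqType) (q : V -> K) (q' : V -> K') f a b :
  (forall x y y', q' y = q' y' -> q (m x y) = q (m x y')) ->
  normalized q f -> stutters q' b -> shsum m f a b = 0.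
Proof.
move=> qm; elim: a b f => [|x a IHa] b f nf; first by rewrite shsum0l.
elim: b f nf => [//|y b IHb] f nf rb.
rewrite shsum_cons IHa ?addr0 //; last exact: normalized_cons.
case: b IHb rb => [//|y' b] IHb /= /orP[/eqP yy'|rb]; rewrite andbF add0r; last first.
  by rewrite IHb ?scaler0 //; apply: normalized_cons.
rewrite (@eq_shsum _ _ _ _ _ (fun=> 0)) ?shsum_eq0 ?scaler0 // => w _ _.
by apply: nf; rewrite /= (qm _ _ _ yy') eqxx.
Qed.

End ShuffleAlgebra.

(** * The maps F and H on vertex sequences *)

Section Homotopy.
Variables (k : comPzRingType) (V : eqType) (m : V -> V -> V) (M : lmodType k).
Implicit Types (f : seq V -> M).

Definition Fpath f w : M := cutsum (shsum m f) w.
(** The sequence t ++ v contains the vertex shared by u and v as the first vertex of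
    v, after the end of the path t: this is the jump.  If u has m + 1 vertices, the
    sign - (-1)^m is the one written here. *)
Definition Hpath f w : M :=
  cutsum (fun u v => (-1) ^+ size u *: Fpath (fun t => f (t ++ v)) u) w.

Lemma eq_Fpath f g w : f =1 g -> Fpath f w = Fpath g w.
Proof. by move=> fg; apply: eq_bigr => i _; apply: eq_shsum_fun. Qed.
Lemma eq_Hpath f g w : f =1 g -> Hpath f w = Hpath g w.
Proof. by move=> fg; apply: eq_bigr => i _; congr (_ *: _); apply: eq_Fpath. Qed.

Lemma eq_Fpath_size f g w :
  (forall t, size t = size w -> f t = g t) -> Fpath f w = Fpath g w.
Proof.
move=> fg; apply: eq_cutsum => u x v ew; apply: eq_shsum_size => y t st.
by apply: fg; apply/eqP; rewrite /= -eqSS st ew size_rcons !size_cat addSn.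
Qed.

Lemma Fpath_add f g w : Fpath (fun t => f t + g t) w = Fpath f w + Fpath g w.
Proof. by rewrite /Fpath -cutsum_add; apply: eq_cutsum => *; rewrite shsum_add. Qed.

Lemma Fpath_scale c f w : Fpath (fun t => c *: f t) w = c *: Fpath f w.
Proof. by rewrite /Fpath -cutsum_scale; apply: eq_cutsum => *; rewrite shsum_scale. Qed.

Lemma Fpath_cut (G : seq V -> seq V -> seq V -> M) v w :
  Fpath (fun t => cutsum (fun v1 v2 => G v1 v2 t) v) w = cutsum (fun v1 v2 => Fpath (G v1 v2) w) v.
Proof.
by rewrite /Fpath cutsum_exchange; apply: eq_cutsum => u x v' _; rewrite shsum_cut_exchange.
Qed.
End Homotopy.

(** The second homotopy cuts the sequence t ++ v, t being a path produced by the
    first one, either in t or in v.  A cut in t leaves v alone, and this is the first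
    sum.  If v is cut into v1 and v2 then t ++ v1 is a term of the first homotopy
    applied to the part of w before v2; this is the second sum.  Its sign is
    opposite because u and v1 share a vertex while t and v1 do not. *)
Lemma Hpath_Hpath (k : comPzRingType) (V : eqType) (M : lmodType k) (n m : V -> V -> V)
    (f : seq V -> M) w :
  Hpath n (Hpath m f) w =
  cutsum (fun u v => (-1) ^+ size u *: Fpath n (Hpath m (fun t => f (t ++ v))) u) w
  - cutsum (fun u v => (-1) ^+ size u *: Hpath n (Fpath m (fun t => f (t ++ v))) u) w.
Proof.
pose G u v1 v2 : M := (-1) ^+ size v1 *:
  Fpath n (fun t => Fpath m (fun r => f (r ++ v2)) (t ++ v1)) u.
have -> : cutsum (fun u v => (-1) ^+ size u *: Hpath n (Fpath m (fun t => f (t ++ v))) u) w =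
    - cutsum (fun u v => cutsum (fun v1 v2 => G u v1 v2) v) w.
  rewrite -cutsum_coassoc -scaleN1r -cutsum_scale; apply: eq_cutsum => u x v _.
  rewrite -!cutsum_scale; apply: eq_cutsum => u1 y u2 eu; rewrite /G !scalerA.
  congr (_ *: _); rewrite -exprD -exprS; apply: signE.
  by rewrite eu !size_cat !size_rcons /=; parity.
rewrite opprK -cutsum_add; apply: eq_cutsum => u x v _.
have E t : size t = size (rcons u x) -> Hpath m f (t ++ x :: v) =
    Hpath m (fun r => f (r ++ x :: v)) t +
    (-1) ^+ size (rcons u x) *: cutsum (fun v1 v2 => (-1) ^+ size v1 *:
      Fpath m (fun r => f (r ++ v2)) (t ++ v1)) (x :: v).
  move=> <-; rewrite /Hpath cutsum_cat -cutsum_scale; congr (_ + _).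
    apply: eq_cutsum => t1 y t2 _; congr (_ *: _); apply: eq_Fpath => r.
    by rewrite catA.
  by apply: eq_cutsum => v1 y v2 _; rewrite size_cat exprD scalerA.
rewrite (eq_Fpath_size n E) Fpath_add scalerDr Fpath_scale scalerA -exprD; congr (_ + _).
rewrite (@signE _ _ 0) ?oddD ?addbb // scale1r Fpath_cut.
by apply: eq_cutsum => v1 y v2 _; rewrite Fpath_scale.
Qed.

(** Each term shuffles two consecutive parts of w and keeps the rest.  A repetition
    in w lies in one of these three parts and survives as a repetition. *)
Lemma Hpath_stutters (k : comPzRingType) (V : eqType) (M : lmodType k) m (f : seq V -> M) w :
  normalized id f -> stutters id w -> Hpath m f w = 0.
Proof.
move=> nf rw; transitivity (cutsum (fun _ _ : seq V => 0 : M) w); last by rewrite /cutsum big1.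
apply: eq_cutsum => u x v ew; move: rw; rewrite ew stutters_split => /orP[ru|rv]; last first.
  rewrite /Fpath /cutsum big1 ?scaler0 // => i _; apply: shsum_eq0 => t.
  by apply/nf/stutters_catr.
rewrite /Fpath (_ : cutsum _ _ = cutsum (fun _ _ : seq V => 0 : M) (rcons u x)).
  by rewrite /cutsum big1 ?scaler0.
have nf' : normalized id (fun t => f (t ++ x :: v)) by move=> t rt; apply/nf/stutters_catl.
apply: eq_cutsum => u1 y u2 eu; move: ru; rewrite eu stutters_split => /orP[r1|r2].
  by apply: (shsum_stutterl (q := id) (q' := id)) => // ? ? ? /= ->.
by apply: (shsum_stutterr (q := id) (q' := id)) => // ? ? ? /= ->.
Qed.

(** The example to keep in mind is that of triples (x, y, z), with qX and qZ the
    first and the last coordinate, mixX taking x from its first argument and the rest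
    from the second one, and mixZ taking z from its second argument and the rest from
    the first one.  Thus mixX governs the splitting X * (Y * Z) and mixZ the splitting
    (X * Y) * Z. *)
Section ThreeFold.
Variables (k : comPzRingType) (V KX KZ : eqType) (qX : V -> KX) (qZ : V -> KZ).
Variables (mixX mixZ : V -> V -> V).
Hypothesis mixX_qX : forall x x' y, qX x = qX x' -> mixX x y = mixX x' y.
Hypothesis mixZ_qZ : forall x y y', qZ y = qZ y' -> mixZ x y = mixZ x y'.
Hypothesis qXmixZ : forall x y, qX (mixZ x y) = qX x.
Hypothesis qZmixX : forall x y, qZ (mixX x y) = qZ y.
Hypothesis mixXZ : forall x y z, mixZ (mixX x y) z = mixX x (mixZ y z).
Variable (M : lmodType k).
Implicit Types (f : seq V -> M) (g : seq V -> seq V -> M).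

(** A term of the homotopy consists of a path over u1 and u2, the jump, and the rest
    of v.  A step in u2 does not move X, so a front part that contains such a step is
    degenerate in X; a front part that goes beyond the jump contains one, unless u2
    has no steps and the jump itself is a repetition.  What is left are the cuts of
    u1, that is, a front part of w and a term of the homotopy of the back part. *)
Lemma HpathZ_cutsum g w :
  (forall u u' v, map qX u = map qX u' -> g u v = g u' v) ->
  (forall u v, stutters qX u -> g u v = 0) ->
  Hpath mixZ (cutsum g) w = cutsum (fun u v => (-1) ^+ (size u).-1 *: Hpath mixZ (g u) v) w.
Proof.
move=> gq gr.
pose G u1 u2 v := (-1) ^+ (size u1 + size u2).-1 *: cutsum (fun a1 a2 =>
  shsum mixZ (fun t => g a1 (t ++ v)) a2 u2) u1.
transitivity (cutsum (fun u v => cutsum (fun u1 u2 => G u1 u2 v) u) w).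
  apply: eq_cutsum => u x v _; rewrite /Fpath -cutsum_scale.
  apply: eq_cutsum => u1 y u2 eu; rewrite /G.
  have -> : size (rcons u x) = (size (rcons u1 y) + size (y :: u2)).-1.
    by rewrite eu size_cat size_rcons /=; lia.
  congr (_ *: _).
  under eq_shsum_fun do rewrite cutsum_cat.
  rewrite shsum_add [X in _ + X](_ : _ = 0) ?addr0; last first.
    rewrite shsum_cut_exchange /cutsum big1 // => -[i _] _ /=.
    set v1 := take i v; set v2 := drop i _.
    have nr z : normalized qX (fun t => g (t ++ x :: z) v2) by move=> t rt; apply/gr/stutters_catl.
    case: u2 eu => [|z u2] eu.
      have [_ exy] : (u, x) = (u1, y) by apply: rcons_inj; rewrite eu cats1.
      case eu1: (rcons u1 y) => [|a0 a]; first by rewrite shsum0l.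
      have ly : last a0 a = y by rewrite -(last_cons a0) -eu1 last_rcons.
      rewrite (@eq_shsum _ _ _ _ _ (fun=> 0)) ?shsum_eq0 // => t _ lt; apply: gr.
      move: lt; case/lastP: t => [|t c]; rewrite /= ?last_rcons ly => lt.
        by rewrite lt qXmixZ exy eqxx.
      by apply/stutters_cons/stutters_join; rewrite lt qXmixZ exy.
    by apply: (@shsum_stutterr _ _ _ _ _ _ qX (fun=> tt)) => //= *; rewrite !qXmixZ.
  rewrite shsum_cut; apply: eq_cutsum => a1 z a2 _.
  rewrite cutsum_head; last first.
    move=> b c b1 b2; rewrite (@shsum_stutterr _ _ _ _ _ _ qX (fun=> tt)) ?scaler0 //=.
      by move=> *; rewrite !qXmixZ.
    by move=> t rt; apply: shsum_eq0 => t'; apply: gr.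
  rewrite mul0n scale1r shsum1r; case ea1: (rcons a1 z) => [|c0 c].
    by case: a1 ea1.
  apply: eq_shsum_fun => t; apply: gq; rewrite -map_comp; apply: eq_map => b /=.
  by rewrite qXmixZ.
pose H3 a1 a2 u2 v := (-1) ^+ ((size a1).-1 + (size a2 + size u2).-1) *:
  shsum mixZ (fun t => g a1 (t ++ v)) a2 u2.
transitivity (cutsum (fun a1 w' =>
  cutsum (fun u' v => cutsum (fun a2 u2 => H3 a1 a2 u2 v) u') w') w).
  rewrite -(cutsum_coassoc (fun a1 u' v => cutsum (fun a2 u2 => H3 a1 a2 u2 v) u')).
  apply: eq_cutsum => u x v _.
  rewrite -(cutsum_coassoc (fun a1 a2 u2 => H3 a1 a2 u2 (x :: v))).
  apply: eq_cutsum => u1 y u2 eu; rewrite /G -cutsum_scale.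
  apply: eq_cutsum => a1 z a2 ea; congr (_ *: _); apply: signE.
  by rewrite ea !size_rcons size_cat /=; congr (odd _); lia.
apply: eq_cutsum => a1 z w' _; rewrite -cutsum_scale; apply: eq_cutsum => u x v _.
rewrite -!cutsum_scale; apply: eq_cutsum => a2 y u2 eu.
rewrite /H3 scalerA exprD eu size_cat !size_rcons /=; congr (_ * _ *: _).
Qed.

(** The homotopy of a shuffle of a and b cuts it twice and shuffles the first two
    pieces in the Z-direction.  A step of a in the second piece does not move Z, so
    the second piece is a piece of b alone.  Associativity then makes the first two
    pieces a shuffle of a piece of a with a path of the homotopy of b; the jump comes
    after it, as in shsum_catr. *)
Lemma shsum_HpathZ f a b :
  normalized id f ->
  shsum mixX (Hpath mixZ f) a b = (-1) ^+ (size a).-1 *: Hpath mixZ (fun b' => shsum mixX f a b') b.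
Proof.
move=> nf.
pose psi a3 b3 u1 u2 := shsum mixX (fun v => shsum mixZ (fun t => f (t ++ v)) u1 u2) a3 b3.
transitivity (cutsum (fun a' a3 => cutsum (fun b' b3 => cutsum (fun b1 b2 =>
   (-1) ^+ ((size b').-1 * (size a3).-1 + (size a' + size b').-1) *:
   shsum mixX (fun u1 => psi a3 b3 u1 b2) a' b1) b') b) a).
  rewrite /Hpath shsum_cut; apply: eq_cutsum => a' x a3 _; apply: eq_cutsum => b' y b3 _.
  rewrite cutsum_scale exprD -scalerA; congr (_ *: _).
  transitivity ((-1) ^+ (size (rcons a' x) + size (rcons b' y)).-1 *:
     shsum mixX (cutsum (psi (x :: a3) (y :: b3))) (rcons a' x) (rcons b' y)).
    rewrite -shsum_scale; apply: eq_shsum_size => z w sw; rewrite shsum_scale -sw.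
    by congr (_ *: _); rewrite /Fpath shsum_cut_exchange.
  congr (_ *: _); rewrite shsum_cut cutsum_last; last first.
    move=> u c d v; rewrite /cutsum big1 // => i _.
    rewrite shsum_eq0 ?scaler0 // => w1.
    rewrite (@shsum_stutterl _ _ _ _ _ _ qZ (fun=> tt)) //= => [*|t rt]; first by rewrite !qZmixX.
    rewrite /psi shsum_eq0 // => v'.
    apply: (@shsum_stutterr _ _ _ _ _ _ id qZ) => //; last by move=> r rr; apply/nf/stutters_catl.
  apply: eq_cutsum => b1 z b2 _; rewrite muln0 scale1r.
  apply: eq_shsum_fun => u1; rewrite shsum1l /psi; apply: eq_shsum_fun => v.
  apply: (@shsum_mapr _ _ _ _ _ qZ) => [*|]; first exact: mixZ_qZ.
  by rewrite /= qZmixX -map_comp; congr (_ :: _); apply: eq_map => d /=; rewrite qZmixX.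
rewrite cutsum_exchange /Hpath -cutsum_scale; apply: eq_cutsum => b' y b3 _.
rewrite cutsum_exchange /Fpath -!cutsum_scale; apply: eq_cutsum => b1 z b2 eb.
have -> : shsum mixZ (fun t => shsum mixX f a (t ++ y :: b3)) (rcons b1 z) (z :: b2) =
   cutsum (fun a' a3 => (-1) ^+ (size (rcons b' y) * (size a3).-1) *:
      shsum mixX (fun u1 => psi a3 (y :: b3) u1 (z :: b2)) a' (rcons b1 z)) a.
  transitivity (shsum mixZ (fun t => cutsum (fun a' a3 =>
      (-1) ^+ (size (rcons b' y) * (size a3).-1) *:
      shsum mixX (fun w1 => shsum mixX (fun w2 => f (w1 ++ w2)) a3 (y :: b3)) a' t) a)
      (rcons b1 z) (z :: b2)).
    apply: eq_shsum_size => t0 t st; rewrite shsum_catr.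
    by have -> : (size t).+1 = size (rcons b' y)
      by move: st; rewrite eb size_cat !size_rcons /=; lia.
  rewrite shsum_cut_exchange; apply: eq_cutsum => a' x a3 _.
  rewrite shsum_scale -shsum_assoc //; congr (_ *: _).
  by apply: eq_shsum_fun => u1; rewrite /psi shsum_exchange.
rewrite -!cutsum_scale; apply: eq_cutsum => a' x a3 ea; rewrite !scalerA -!exprD.
congr (_ *: _); apply: signE.
by rewrite ea !size_rcons size_cat !addnS !addSn /=; parity.
Qed.

Lemma HpathZ_FpathX f w : normalized id f ->
  Hpath mixZ (Fpath mixX f) w = Fpath mixX (Hpath mixZ f) w.
Proof.
move=> nf; rewrite /Fpath HpathZ_cutsum.
- by apply: eq_cutsum => u x v _; rewrite shsum_HpathZ.
- by move=> u u' v; apply: shsum_mapl.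
- move=> u v; apply: (@shsum_stutterl _ _ _ _ _ _ id) => //; exact: mixX_qX.
Qed.

(** The path over u1 and u2 reaches its last Z-coordinate at its end, and the jump
    keeps it.  Hence a cut before the jump leaves a back part that is degenerate in Z,
    and the remaining cuts are those of v. *)
Lemma HpathX_cutsum g w :
  (forall u v, stutters qZ v -> g u v = 0) ->
  Hpath mixX (cutsum g) w = cutsum (fun u v => Hpath mixX (g^~ v) u) w.
Proof.
move=> gr.
pose G u v1 v2 := (-1) ^+ size u *: Fpath mixX (fun t => g (t ++ v1) v2) u.
transitivity (cutsum (fun u v => cutsum (fun v1 v2 => G u v1 v2) v) w); last first.
  by rewrite -cutsum_coassoc.
apply: eq_cutsum => u x v _; rewrite cutsum_scale; congr (_ *: _); rewrite /Fpath.
rewrite cutsum_exchange; apply: eq_cutsum => u1 y u2 eu.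
under eq_shsum_fun do rewrite cutsum_cat.
rewrite shsum_add shsum_cut_exchange [X in X + _](_ : _ = 0) ?add0r //.
case eu1: (rcons u1 y) => [|a0 a]; first by rewrite shsum0l.
rewrite (@eq_shsum _ _ _ _ _ (fun=> 0)) ?shsum_eq0 // => t st lt.
rewrite /cutsum big1 // => -[i /= it] _; apply: gr.
have lx : last y u2 = x by rewrite -(last_cons y) -[RHS](last_rcons y u x) eu last_cat.
rewrite lastI drop_rcons; last by rewrite size_belast.
by apply: stutters_join; rewrite lt qZmixX lx.
Qed.

(** The homotopy of a shuffle of a and b cuts it twice and shuffles the first two
    pieces in the X-direction.  A step of b in the first piece does not move X, so the
    first piece is a piece of a alone.  The rest is as for shsum_HpathZ, with
    shsum_catl instead of shsum_catr. *)
Lemma shsum_HpathX f a b :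
  normalized id f -> shsum mixZ (Hpath mixX f) a b = Hpath mixX (fun a' => shsum mixZ f a' b) a.
Proof.
move=> nf.
pose psi a3 b3 u1 u2 := shsum mixZ (fun v => shsum mixX (fun t => f (t ++ v)) u1 u2) a3 b3.
transitivity (cutsum (fun a' a3 => cutsum (fun b' b3 => cutsum (fun a1 a2 =>
   (-1) ^+ ((size b').-1 * (size a3).-1 + (size a' + size b').-1) *:
   shsum mixZ (fun u2 => psi a3 b3 a1 u2) a2 b') a') b) a).
  rewrite /Hpath shsum_cut; apply: eq_cutsum => a' x a3 _; apply: eq_cutsum => b' y b3 _.
  rewrite cutsum_scale exprD -scalerA; congr (_ *: _).
  transitivity ((-1) ^+ (size (rcons a' x) + size (rcons b' y)).-1 *:
     shsum mixZ (cutsum (psi (x :: a3) (y :: b3))) (rcons a' x) (rcons b' y)).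
    rewrite -shsum_scale; apply: eq_shsum_size => z w sw; rewrite shsum_scale -sw.
    by congr (_ *: _); rewrite /Fpath shsum_cut_exchange.
  congr (_ *: _); rewrite shsum_cut; apply: eq_cutsum => a1 z a2 _.
  case eb: (rcons b' y) => [|b0 b'']; first by rewrite cutsum_nil shsum0r.
  rewrite cutsum_head; last first.
    move=> c d u v; rewrite (@shsum_stutterr _ _ _ _ _ _ qX (fun=> tt)) ?scaler0 //=.
      by move=> *; rewrite !qXmixZ.
    move=> t rt; rewrite shsum_eq0 // => w2; rewrite /psi shsum_eq0 // => v'.
    apply: (@shsum_stutterl _ _ _ _ _ _ id qX) => //; last by move=> r rr; apply/nf/stutters_catl.
  rewrite mul0n scale1r shsum1r; case ea1: (rcons a1 z) => [|c0 c].
    by case: a1 ea1.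
  apply: eq_shsum_fun => u2; rewrite /psi; apply: eq_shsum_fun => v.
  apply: (@shsum_mapl _ _ _ _ _ qX) => [*|]; first exact: mixX_qX.
  by rewrite -map_comp; apply: eq_map => d /=; rewrite qXmixZ.
rewrite /Hpath; apply: eq_cutsum => a' x a3 _.
rewrite cutsum_exchange /Fpath -!cutsum_scale; apply: eq_cutsum => a1 z a2 ea.
have -> : shsum mixX (fun t => shsum mixZ f (t ++ x :: a3) b) (rcons a1 z) (z :: a2) =
   cutsum (fun b' b3 => (-1) ^+ ((size b').-1 * (size a3).+1) *:
      shsum mixZ (fun u2 => psi (x :: a3) b3 (rcons a1 z) u2) (z :: a2) b') b.
  transitivity (shsum mixX (fun t => cutsum (fun b' b3 =>
      (-1) ^+ ((size b').-1 * (size a3).+1) *: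
      shsum mixZ (fun w1 => shsum mixZ (fun w2 => f (w1 ++ w2)) (x :: a3) b3) t b') b)
      (rcons a1 z) (z :: a2)).
    by apply: eq_shsum_size => t0 t _; rewrite shsum_catl.
  rewrite shsum_cut_exchange; apply: eq_cutsum => b' y b3 _.
  rewrite shsum_scale shsum_assoc //; congr (_ *: _).
  by apply: eq_shsum_fun => u1; rewrite /psi shsum_exchange.
rewrite -!cutsum_scale; apply: eq_cutsum => b' y b3 _; rewrite !scalerA -!exprD.
by congr (_ *: _); apply: signE; rewrite !size_rcons /=; parity.
Qed.

Lemma HpathX_FpathZ f w : normalized id f ->
  Hpath mixX (Fpath mixZ f) w = Fpath mixZ (Hpath mixX f) w.
Proof.
move=> nf; rewrite /Fpath HpathX_cutsum; last first.
  by move=> u v; apply: (@shsum_stutterr _ _ _ _ _ _ id) => //; exact: mixZ_qZ.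
by apply: eq_cutsum => u x v _; rewrite shsum_HpathX.
Qed.

Lemma Hpath_anticomm f w : normalized id f ->
  Hpath mixX (Hpath mixZ f) w = - Hpath mixZ (Hpath mixX f) w.
Proof.
move=> nf; rewrite !Hpath_Hpath opprB; congr (_ - _); apply: eq_cutsum => u x v _.
  by rewrite HpathZ_FpathX // => t rt; apply/nf/stutters_catl.
by rewrite HpathX_FpathZ // => t rt; apply/nf/stutters_catl.
Qed.
End ThreeFold.

(** * Simplices with prescribed vertices *)

Section Simplicial.
Local Open Scope nat_scope.
Variable X : sset.
Implicit Types (u : simplex X).

Lemma tag_sface i u : tag (sface i u) = (tag u).-1. Proof. by case: u => [[]]. Qed.

Lemma sface_sface i j u : i < j <= tag u -> 1 < tag u ->
  sface i (sface j u) = sface j.-1 (sface i u).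
Proof. by case: u => [[|[|n]] x] //= ij _; congr smk; exact: face_face. Qed.

Lemma sface_sdegen_lt i j u : i < j <= tag u ->
  sface i (sdegen j u) = sdegen j.-1 (sface i u).
Proof.
case: u => [[|n] x] /=; first by case: j => [|j]; rewrite ?ltn0 ?andbF.
by move=> ij; congr smk; exact: face_degen_lt.
Qed.

Lemma sface_sdegen_eq j u : j <= tag u -> sface j (sdegen j u) = u.
Proof. by case: u => n x /= jn; rewrite /sdegen /= face_degen_eq. Qed.

Lemma sface_sdegen_eqS j u : j <= tag u -> sface j.+1 (sdegen j u) = u.
Proof. by case: u => n x /= jn; rewrite /sdegen /= face_degen_eqS. Qed.

Lemma sface_sdegen_gt i j u : j.+1 < i <= (tag u).+1 -> 0 < tag u ->
  sface i (sdegen j u) = sdegen j (sface i.-1 u).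
Proof. by case: u => [[|n] x] //= ij _; congr smk; exact: face_degen_gt. Qed.

Lemma sdegen_sdegen i j u : i <= j <= tag u ->
  sdegen i (sdegen j u) = sdegen j.+1 (sdegen i u).
Proof. by case: u => n x /= ij; congr smk; exact: degen_degen. Qed.

#[local] Arguments sface : simpl never.

(** A monotone map into [n] is given by the multiplicities c_j of its values j.  The
    operator for j is a face if c_j = 0 and an iterated degeneracy otherwise.
    Processing the values from the last to the first leaves the indices of those
    still to be treated unchanged. *)
Definition vertex_op j c u := if c is c'.+1 then iter c' (sdegen j) u else sface j u.
Fixpoint vertex_ops j (cs : seq nat) u :=
  if cs is c :: cs' then vertex_op j c (vertex_ops j.+1 cs' u) else u.

Lemma tag_iter_sdegen c j u : tag (iter c (sdegen j) u) = c + tag u.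
Proof. by elim: c => //= c ->. Qed.

Lemma tag_vertex_ops j cs u : (tag u).+1 = j + size cs -> 0 < j + sumn cs ->
  (tag (vertex_ops j cs u)).+1 = j + sumn cs.
Proof.
elim: cs j => [|c cs IHcs] j /=; first by rewrite !addn0 => ->.
move=> tu js; have := IHcs j.+1; rewrite tu addSnnS => /(_ erefl isT) tv.
case: c js => [|c] /= js; last by rewrite tag_iter_sdegen; lia.
by rewrite tag_sface; lia.
Qed.

Lemma sdegen_iter_in i j c u : i <= c -> j <= tag u ->
  sdegen (j + i) (iter c (sdegen j) u) = iter c.+1 (sdegen j) u.
Proof.
elim: c i => [|c IHc] [|i] //= ic ju; rewrite ?addn0 //.
by rewrite addnS -sdegen_sdegen ?IHc // leq_addr tag_iter_sdegen; lia.
Qed.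

Lemma sdegen_iter_gt i j c u : j + i <= tag u ->
  sdegen (c + (j + i)) (iter c (sdegen j) u) = iter c (sdegen j) (sdegen (j + i) u).
Proof.
elim: c => [|c IHc] //= jiu.
by rewrite addSn -sdegen_sdegen ?IHc // tag_iter_sdegen; lia.
Qed.

Lemma sface_iter_in i j c u : i <= c.+1 -> j <= tag u ->
  sface (j + i) (iter c.+1 (sdegen j) u) = iter c (sdegen j) u.
Proof.
elim: c i => [|c IHc] i ic ju.
  case: i ic => [|[|i]] //= _; rewrite ?addn0 ?addn1.
    exact: sface_sdegen_eq.
  exact: sface_sdegen_eqS.
have tw : tag (iter c.+1 (sdegen j) u) = c.+1 + tag u by rewrite tag_iter_sdegen.
case: i ic => [|[|i]] ic; rewrite iterS ?addn0 ?addn1.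
- by rewrite sface_sdegen_eq // tw; lia.
- by rewrite sface_sdegen_eqS // tw; lia.
by rewrite sface_sdegen_gt ?tw; [rewrite addnS [_.-1]/= IHc //; lia | lia | lia].
Qed.

Lemma sface_iter_gt i j c u : j < i <= tag u ->
  sface (c + i) (iter c (sdegen j) u) = iter c (sdegen j) (sface i u).
Proof.
elim: c => [|c IHc] // jiu; rewrite iterS.
by rewrite sface_sdegen_gt ?tag_iter_sdegen; [rewrite addSn [_.-1]/= IHc | lia | lia].
Qed.

(** Position i of the sequence with multiplicities cs lies in the block of one value;
    duplicating or deleting this position only changes that multiplicity. *)
Fixpoint incr_block i (cs : seq nat) :=
  if cs is c :: cs' then if i < c then c.+1 :: cs' else c :: incr_block (i - c) cs' else [::].
Fixpoint decr_block i (cs : seq nat) :=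
  if cs is c :: cs' then if i < c then c.-1 :: cs' else c :: decr_block (i - c) cs' else [::].

Lemma sdegen_vertex_ops i j cs u : (tag u).+1 = j + size cs -> i < sumn cs ->
  sdegen (j + i) (vertex_ops j cs u) = vertex_ops j (incr_block i cs) u.
Proof.
elim: cs i j => [//|c cs IHcs] i j /= tu ics.
have tu' : (tag u).+1 = j.+1 + size cs by rewrite tu addSnnS.
have := tag_vertex_ops tu' isT; case: ltnP => [ic|ci] tv.
  by case: c ic ics => [//|c] ic _ /=; rewrite sdegen_iter_in //; lia.
have ics' : i - c < sumn cs by lia.
have {IHcs} IH := IHcs _ _ tu' ics'; rewrite /= -IH.
case: c ci {ics IH} ics' => [|c] ci ics' /=.
  by rewrite subn0 sface_sdegen_lt //; lia.
have -> : j + i = c + (j + (i - c)) by lia.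
by rewrite sdegen_iter_gt; [congr (iter _ _ (sdegen _ _)); lia | lia].
Qed.

Lemma sface_vertex_ops i j cs u : (tag u).+1 = j + size cs -> i < sumn cs ->
  1 < j + sumn cs -> sface (j + i) (vertex_ops j cs u) = vertex_ops j (decr_block i cs) u.
Proof.
elim: cs i j => [//|c cs IHcs] i j /= tu ics jcs.
have tu' : (tag u).+1 = j.+1 + size cs by rewrite tu addSnnS.
have := tag_vertex_ops tu' isT; case: ltnP => [ic|ci] tv.
  case: c ic {ics jcs} => [//|[|c]] ic /=; last by rewrite -iterS sface_iter_in //; lia.
  by case: i ic => // _; rewrite addn0.
have ics' : i - c < sumn cs by lia.
have jcs' : 1 < j.+1 + sumn cs by lia.
have {IHcs} IH := IHcs _ _ tu' ics' jcs'; rewrite /= -IH.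
case: c ci {ics IH} jcs ics' => [|c] ci jcs ics' /=.
  rewrite subn0 [RHS]sface_sface //; lia.
have -> : j + i = c + (j + (i - c)) by lia.
by rewrite sface_iter_gt; [congr (iter _ _ (sface _ _)); lia | lia].
Qed.

Definition mults j r (l : seq nat) := [seq count_mem v l | v <- iota j r].
(** For a weakly increasing l this is the image of u under the monotone map with
    values l. *)
Definition act (l : seq nat) u := vertex_ops 0 (mults 0 (tag u).+1 l) u.

Definition inrange j r (l : seq nat) := sorted leq l && all (fun i => j <= i < j + r) l.

Lemma inrange_split j r l : inrange j r.+1 l ->
  exists2 l', l = nseq (count_mem j l) j ++ l' & inrange j.+1 r l'.
Proof.
elim: l => [|i l IHl] /=; first by exists [::].
move=> /andP[/= pl /andP[ij al]]; have [|l' el rl'] := IHl.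
  by rewrite /inrange al (path_sorted pl).
case: eqVneq => [->|nij]; first by exists l'; rewrite //= -el.
exists (i :: l).
  have -> : count_mem j l = 0.
    apply/count_memPn/negP => jl.
    by have /allP/(_ _ jl) := order_path_min leq_trans pl; lia.
  by [].
rewrite /inrange /= pl /= addSnnS; apply/andP; split; first by lia.
apply/allP => x xl; have /allP/(_ _ xl) := order_path_min leq_trans pl.
by have /allP/(_ _ xl) := al; lia.
Qed.

Lemma multsS j r l l' : inrange j.+1 r l' -> forall c,
  l = nseq c j ++ l' -> mults j r.+1 l = c :: mults j.+1 r l'.
Proof.
move=> /andP[_ /allP al'] c ->; rewrite /mults /= count_cat count_nseq /= eqxx mul1n.
have -> : count_mem j l' = 0 by apply/count_memPn/negP => /al'; lia.
rewrite addn0; congr (_ :: _); apply/eq_in_map => v; rewrite mem_iota => vj.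
by rewrite count_cat count_nseq /=; case: eqP => [?|]; lia.
Qed.

Lemma size_mults j r l : size (mults j r l) = r.
Proof. by rewrite size_map size_iota. Qed.

Lemma sumn_mults j r l : inrange j r l -> sumn (mults j r l) = size l.
Proof.
elim: r j l => [|r IHr] j l.
  by case: l => //= i l /andP[_ /= /andP[]]; lia.
move=> /inrange_split[l' el rl']; rewrite (multsS rl' el) /= IHr //.
by rewrite {2}el size_cat size_nseq.
Qed.

(** Position size l1 lies in the initial block, that of j, exactly when it is smaller
    than the multiplicity of j. *)
Lemma inrange_split_at j r l1 x l2 : inrange j r.+1 (l1 ++ x :: l2) ->
  let c := count_mem j (l1 ++ x :: l2) in
  if size l1 < c then x = j else
  [/\ l1 ++ x :: l2 = nseq c j ++ drop c l1 ++ x :: l2,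
      inrange j.+1 r (drop c l1 ++ x :: l2) & j < x].
Proof.
move=> rl; have [l' el rl'] := inrange_split rl; move: el => /=.
set c := count_mem j _ => el; case: ltnP => cl.
  have := congr1 (fun s => nth 0 s (size l1)) el.
  by rewrite nth_cat ltnn subnn nth_cat size_nseq cl nth_nseq cl.
have el' : l' = drop c l1 ++ x :: l2.
  have := congr1 (drop c) el; rewrite (@drop_size_cat _ c (nseq c j)) ?size_nseq // => <-.
  rewrite drop_cat; case: ltnP => // lc.
  have -> : c = size l1 by apply/eqP; rewrite eqn_leq cl lc.
  by rewrite subnn drop0 drop_size.
rewrite -el' -el; split=> //; case/andP: rl' => _ /allP/(_ x).
by rewrite el' mem_cat inE eqxx orbT => /(_ isT) /andP[].
Qed.

Lemma incr_block_mults j r l1 x l2 : inrange j r (l1 ++ x :: l2) ->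
  incr_block (size l1) (mults j r (l1 ++ x :: l2)) = mults j r (l1 ++ x :: x :: l2).
Proof.
have -> : mults j r (l1 ++ x :: x :: l2) =
    [seq (x == v) + count_mem v (l1 ++ x :: l2) | v <- iota j r].
  by apply: eq_map => v; rewrite !count_cat /= addnCA.
elim: r j l1 => [|r IHr] j l1.
  by rewrite /inrange all_cat /= => /and3P[_ _ /andP[]]; lia.
move=> /inrange_split_at; cbv zeta; set c := count_mem j _.
case: ltnP => cl; last move=> [el rl' jx].
  move=> xj; rewrite /mults /= -/c cl; congr cons; first by rewrite xj eqxx.
  by apply/eq_in_map => v; rewrite mem_iota; case: eqP; lia.
have cv v : j < v -> count_mem v (l1 ++ x :: l2) = count_mem v (drop c l1 ++ x :: l2).
  by move=> jv; rewrite {1}el count_cat count_nseq /=; case: eqP => [?|//]; lia.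
rewrite {1}(multsS rl' el) /= ltnNge cl /= gtn_eqF // add0n; congr cons.
rewrite -size_drop IHr //; apply/eq_in_map => v; rewrite mem_iota => /andP[jv _].
by rewrite cv.
Qed.

Lemma decr_block_mults j r l1 x l2 : inrange j r (l1 ++ x :: l2) ->
  decr_block (size l1) (mults j r (l1 ++ x :: l2)) = mults j r (l1 ++ l2).
Proof.
have -> : mults j r (l1 ++ l2) =
    [seq count_mem v (l1 ++ x :: l2) - (x == v) | v <- iota j r].
  by apply: eq_map => v; rewrite !count_cat /= addnCA addKn.
elim: r j l1 => [|r IHr] j l1.
  by rewrite /inrange all_cat /= => /and3P[_ _ /andP[]]; lia.
move=> /inrange_split_at; cbv zeta; set c := count_mem j _.
case: ltnP => cl; last move=> [el rl' jx].
  move=> xj; rewrite /mults /= -/c cl; congr cons; first by rewrite xj eqxx subn1.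
  by apply/eq_in_map => v; rewrite mem_iota; case: eqP => [|_]; [lia|rewrite subn0].
have cv v : j < v -> count_mem v (l1 ++ x :: l2) = count_mem v (drop c l1 ++ x :: l2).
  by move=> jv; rewrite {1}el count_cat count_nseq /=; case: eqP => [?|//]; lia.
rewrite {1}(multsS rl' el) /= ltnNge cl /= gtn_eqF // subn0; congr cons.
rewrite -size_drop IHr //; apply/eq_in_map => v; rewrite mem_iota => /andP[jv _].
by rewrite cv.
Qed.

Section Act.
Variable u : simplex X.
Let good l := (l != [::]) && inrange 0 (tag u).+1 l.

Lemma tag_act l : good l -> tag (act l u) = (size l).-1.
Proof.
move=> /andP[l0 rl]; apply: succn_inj; rewrite tag_vertex_ops ?add0n ?sumn_mults ?size_mults //.
  by case: l l0 {rl}.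
by case: l l0 {rl}.
Qed.

Lemma sdegen_act l1 x l2 : good (l1 ++ x :: l2) ->
  sdegen (size l1) (act (l1 ++ x :: l2) u) = act (l1 ++ x :: x :: l2) u.
Proof.
move=> /andP[_ rl]; rewrite /act -incr_block_mults // -sdegen_vertex_ops ?size_mults //.
by rewrite sumn_mults // size_cat /=; lia.
Qed.

Lemma sface_act l1 x l2 : good (l1 ++ x :: l2) -> l1 ++ l2 != [::] ->
  sface (size l1) (act (l1 ++ x :: l2) u) = act (l1 ++ l2) u.
Proof.
move=> /andP[_ rl] nl; rewrite /act -(decr_block_mults rl) -sface_vertex_ops ?size_mults //.
  by rewrite sumn_mults // size_cat /=; lia.
by rewrite sumn_mults // add0n size_cat addnS -size_cat ltnS; case: (l1 ++ l2) nl.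
Qed.

Lemma act_iota : act (iota 0 (tag u).+1) u = u.
Proof.
rewrite /act (_ : mults _ _ _ = nseq (tag u).+1 1); last first.
  apply: (@eq_from_nth _ 0); rewrite size_mults ?size_nseq // => i iu.
  rewrite (nth_map 0) ?size_iota // nth_nseq iu nth_iota // add0n.
  by rewrite count_uniq_mem ?iota_uniq // mem_iota iu.
have E n j : vertex_ops j (nseq n 1) u = u by elim: n j => //= n IHn j; rewrite IHn.
exact: E.
Qed.
End Act.
End Simplicial.

(** * Shuffles as subsets *)

Section SetShuffle.

Definition set_mask n (A : {set 'I_n}) : seq bool := [seq i \in A | i <- enum 'I_n].

Lemma size_set_mask n (A : {set 'I_n}) : size (set_mask A) = n.
Proof. by rewrite size_map size_enum_ord. Qed.

Lemma set_maskC n (A : {set 'I_n}) : set_mask (~: A) = map negb (set_mask A).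
Proof. by rewrite -map_comp; apply: eq_map => i; rewrite /= inE. Qed.

Lemma enum_set_mask n (A : {set 'I_n}) : map val (enum A) = mask (set_mask A) (iota 0 n).
Proof.
rewrite -[iota 0 n]val_enum_ord -map_mask /set_mask -filter_mask.
by rewrite enumT -[RHS]/(map val _).
Qed.

Lemma count_set_mask n (A : {set 'I_n}) : count id (set_mask A) = #|A|.
Proof.
rewrite cardE -(size_map val) enum_set_mask size_mask //.
by rewrite size_set_mask size_iota.
Qed.

Definition set_cons n (b : bool) (B : {set 'I_n}) : {set 'I_n.+1} :=
  [set i | if unlift ord0 i is Some j then j \in B else b].

Lemma set_mask_cons n b (B : {set 'I_n}) : set_mask (set_cons b B) = b :: set_mask B.
Proof.
rewrite /set_mask enum_ordSl /= inE unlift_none -map_comp; congr (_ :: _).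
by apply: eq_map => i /=; rewrite inE liftK.
Qed.

Lemma enum_set_cons n b (B : {set 'I_n}) :
  enum (set_cons b B) = (if b then [:: ord0] else [::]) ++ map (lift ord0) (enum B).
Proof.
apply: (inj_map val_inj); rewrite enum_set_mask set_mask_cons map_cat -map_comp /=.
have -> : map (val \o lift ord0) (enum B) = map S (map val (enum B)).
  by rewrite -map_comp; apply: eq_map => i /=.
rewrite enum_set_mask map_mask -(iotaDl 1 0).
by case: b => //=; rewrite (@eq_map _ _ _ S) // => i; rewrite add1n.
Qed.

Lemma set_consC n b (B : {set 'I_n}) : ~: set_cons b B = set_cons (~~ b) (~: B).
Proof.
by apply/setP => i; rewrite !inE; case: (unlift ord0 i) => // j; rewrite inE.
Qed.

(** When 0 is in the complement it is the entry number #|B| of the one-line notation,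
    and moving it to the front costs #|B| transpositions. *)
Lemma odd_shuffle_cons n b (B : {set 'I_n}) :
  odd_perm (shuffle_perm (set_cons b B)) =
  (~~ b && odd #|B|) (+) odd_perm (shuffle_perm B).
Proof.
have Bn : (#|B| < n.+1)%N by rewrite ltnS -[X in (_ <= X)%N]card_ord max_card.
pose i0 : 'I_n.+1 := if b then ord0 else Ordinal Bn.
have -> : shuffle_perm (set_cons b B) = lift_perm i0 ord0 (shuffle_perm B).
  have szL : size (enum B ++ enum (~: B)) = n.
    by rewrite size_cat -!cardE cardsC card_ord.
  have szF : size (enum (set_cons b B) ++ enum (~: set_cons b B)) = n.+1.
    by rewrite size_cat -!cardE cardsC card_ord.
  apply/permP => i; rewrite permE /shuffle_fun.
  case: (unliftP i0 i) => [j ->|->]; rewrite ?lift_perm_lift ?lift_perm_id; last first.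
    rewrite set_consC !enum_set_cons /i0; case: b {i0 szF} => //=.
    by rewrite nth_cat size_map -cardE ltnn subnn.
  rewrite permE /shuffle_fun (set_nth_default (lift ord0 j)) ?szF //.
  rewrite -(nth_map _ (lift ord0 j)) ?szL // map_cat set_consC !enum_set_cons /i0.
  case: b {i0 szF} => //=.
  rewrite nth_cat [RHS]nth_cat size_map -cardE /= /bump.
  case: (leqP #|B| j) => [Bj|jB]; last by rewrite add0n jB.
  by rewrite add1n ltnNge (leqW Bj) subSn.
by rewrite odd_lift_perm addbF /i0; case: (b).
Qed.

Section Sum.
Variables (k : pzRingType) (M : lmodType k).
Implicit Types (G : seq bool -> M).

Definition subset_shsum n p G : M :=
  \sum_(A : {set 'I_n} | #|A| == p) (-1) ^+ odd_perm (shuffle_perm A) *: G (set_mask A).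

Lemma eq_subset_shsum n p G G' :
  (forall t, size t = n -> count id t = p -> G t = G' t) ->
  subset_shsum n p G = subset_shsum n p G'.
Proof.
move=> eG; apply: eq_bigr => A /eqP Ap; rewrite eG ?size_set_mask //.
by rewrite count_set_mask.
Qed.

Lemma subset_shsum_gt n p G : (n < p)%N -> subset_shsum n p G = 0.
Proof.
move=> np; apply: big1 => A /eqP Ap; have := max_card A.
by rewrite Ap card_ord leqNgt np.
Qed.

Lemma subset_shsum0 G : subset_shsum 0 0 G = G [::].
Proof.
rewrite /subset_shsum (big_pred1 set0) => [|A]; last first.
  by rewrite /= cards_eq0.
have -> : shuffle_perm (@set0 'I_0) = 1%g by apply/permP => -[].
by rewrite odd_perm1 scale1r (size0nil (size_set_mask _)).
Qed.

(** The recursion satisfied by lattice paths: the first step is in the set (a step of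
    the first factor) or in its complement (a step of the second factor, which passes
    the p elements of the set). *)
Lemma subset_shsumS n p G : subset_shsum n.+1 p G =
  (if p is p'.+1 then subset_shsum n p' (fun t => G (true :: t)) else 0) +
  (-1) ^+ p *: subset_shsum n p (fun t => G (false :: t)).
Proof.
have consK b (A : {set 'I_n.+1}) :
    (ord0 \in A) == b -> set_cons b [set i | lift ord0 i \in A] = A.
  move=> /eqP Ab; apply/setP => i; rewrite inE.
  by case: unliftP => [j ->|->]; rewrite ?inE.
have Kcons b (B : {set 'I_n}) : [set i | lift ord0 i \in set_cons b B] = B.
  by apply/setP => i; rewrite !inE liftK.
have card_cons b (B : {set 'I_n}) : #|set_cons b B| = (b + #|B|)%N.
  by rewrite -!count_set_mask set_mask_cons.
have part b : \sum_(A : {set 'I_n.+1} | (#|A| == p) && ((ord0 \in A) == b))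
      (-1) ^+ odd_perm (shuffle_perm A) *: G (set_mask A) =
    \sum_(B : {set 'I_n} | (b + #|B|)%N == p)
      (-1) ^+ ((~~ b && odd #|B|) (+) odd_perm (shuffle_perm B)) *: G (b :: set_mask B).
  rewrite (reindex_onto (@set_cons n b) (fun A : {set 'I_n.+1} => [set i | lift ord0 i \in A])) /=.
    apply: eq_big => [B|B _]; last by rewrite odd_shuffle_cons set_mask_cons.
    by rewrite card_cons Kcons eqxx andbT inE unlift_none eqxx andbT.
  by move=> A /andP[_ Ab]; apply: consK.
rewrite /subset_shsum (bigID (fun A : {set 'I_n.+1} => ord0 \in A)) /=; congr (_ + _).
  under eq_bigl do rewrite -[X in _ && X]eqb_id.
  by rewrite part; case: p {part} => [|p]; [rewrite big1|apply: eq_big].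
under eq_bigl do rewrite -[X in _ && X]eqbF_neg.
rewrite part scaler_sumr; apply: eq_big => // B /eqP <-.
by rewrite /= signr_addb signr_odd scalerA.
Qed.
End Sum.
End SetShuffle.

(** * Linear maps on chains and tensor products *)

Lemma qlift_linear (k : pzRingType) (V : lmodType k) (S : V -> Prop) (M : lmodType k)
    (f : {linear V -> M}) :
  (forall w, S w -> f w = 0) -> linear (qlift f : quotmod S -> M).
Proof.
move=> f0 a p q; rewrite -(qreprK p) -(qreprK q) -[a *: _]/(qscale _ _) qscaleE.
by rewrite -qprojD !qliftE // linearP.
Qed.

Fact qproj_linear (k : pzRingType) (V : lmodType k) (S : V -> Prop) : linear (qproj S).
Proof. by move=> a u v; rewrite qprojD -qscaleE. Qed.
HB.instance Definition _ (k : pzRingType) (V : lmodType k) (S : V -> Prop) :=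
  GRing.isLinear.Build k V (quotmod S) *:%R (qproj S) (qproj_linear S).

Lemma qproj_eq0 (k : pzRingType) (V : lmodType k) (S : V -> Prop) w : S w -> qproj S w = 0.
Proof.
move=> Sw; rewrite -[RHS](linear0 (qproj S)); apply/qprojP; rewrite subr0.
by exists 1%N, (fun=> 1), (fun=> w); split=> //; rewrite big_ord1 scale1r.
Qed.

Lemma freemod_sum (k : pzRingType) (T : choiceType) (v : freemod k T) :
  v = \sum_(x <- msupp (v : {malg k[T]})) (v : {malg k[T]})@_x *: fm_gen k x.
Proof.
rewrite [LHS]monalgE; apply: eq_bigr => x _; apply/malgP => y.
by rewrite [RHS]fm_scaleE !mcoeffU mulrnAr mulr1.
Qed.

Lemma tens0l (k : comPzRingType) (M N : lmodType k) (y : N) : tens (0 : M) y = 0.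
Proof.
have /qproj_eq0/eqP := BilinZl 0 (0 : M) y.
by rewrite linearB subr_eq0 !scale0r linear0 => /eqP.
Qed.

Lemma tens0r (k : comPzRingType) (M N : lmodType k) (x : M) : tens x (0 : N) = 0.
Proof.
have /qproj_eq0/eqP := BilinZr 0 x (0 : N).
by rewrite linearB subr_eq0 !scale0r linear0 => /eqP.
Qed.

Lemma tens_lift_linear (k : comPzRingType) (M N P : lmodType k) (f : M -> N -> P) :
  (forall z, linear (f z)) -> (forall z, linear (f^~ z)) -> linear (tens_lift f).
Proof.
move=> fr fl; apply: qlift_linear => w bw.
pose f1 z : {linear N -> P} := HB.pack (f z) (GRing.isLinear.Build _ _ _ _ _ (fr z)).
pose f2 z : {linear M -> P} := HB.pack (f^~ z) (GRing.isLinear.Build _ _ _ _ _ (fl z)).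
have f1E z t : f z t = f1 z t by [].
have f2E z t : f t z = f2 z t by [].
case: bw => *; rewrite !linearB ?linearZ /= !fm_ext_gen /=.
- by rewrite !f2E linearD -addrA -opprD subrr.
- by rewrite !f1E linearD -addrA -opprD subrr.
- by rewrite !f2E linearZ scalerN subrr.
- by rewrite !f1E linearZ scalerN subrr.
Qed.

Section ChainMaps.
Variable k : comPzRingType.
Implicit Types (X Y : sset) (M : lmodType k).

Definition kills_degenerate X M (f : simplex X -> M) := forall v, degenerate v -> f v = 0.

Lemma Cext_linear X M (f : simplex X -> M) : kills_degenerate f -> linear (Cext (k := k) f).
Proof.
by move=> f0; apply: qlift_linear => _ [v vd ->] /=; rewrite fm_ext_gen f0.
Qed.

(** Chains are spanned by the classes of simplices. *)
Lemma eq_linear_C X M (f g : {linear C k X -> M}) :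
  (forall u, f (cls k u) = g (cls k u)) -> f =1 g.
Proof.
move=> fg c; rewrite -(qreprK c) [qrepr c]freemod_sum !linear_sum.
by apply: eq_bigr => x _; rewrite !linearZ; congr (_ *: _); apply: fg.
Qed.

Lemma cls_degenerate X (u : simplex X) : degenerate u -> cls k u = 0.
Proof.
by move=> du; apply: qproj_eq0; exists u.
Qed.

Lemma cpairE X Y (u : simplex (sprod X Y)) : cpair k (sfst u) (ssnd u) = cls k u.
Proof. by case: u => n [x y]; rewrite /cpair /untag /=; case: eqP => // e; rewrite eq_axiomK. Qed.

Lemma Cext_eq0 X M (f : simplex X -> M) (c : C k X) : (forall u, f u = 0) -> Cext f c = 0.
Proof. by move=> f0; rewrite /Cext /qlift /fm_ext big1 // => x _; rewrite f0 scaler0. Qed.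

Lemma Cext_comb X M (a : k) (f g h : simplex X -> M) (c : C k X) :
  (forall u, h u = a *: f u + g u) -> Cext h c = a *: Cext f c + Cext g c.
Proof.
move=> hE; rewrite /Cext /qlift /fm_ext scaler_sumr -big_split; apply: eq_bigr => x _ /=.
by rewrite hE scalerDr !scalerA mulrC.
Qed.

Section Bilinear.
Variables (X Y : sset) (M : lmodType k) (f : simplex X -> simplex Y -> M).
Hypothesis fl : forall y, kills_degenerate (f^~ y).
Hypothesis fr : forall x, kills_degenerate (f x).
Let g (c : C k X) (d : C k Y) := Cext (fun x => Cext (fun y => f x y) d) c.

Let gl d : linear (g^~ d).
Proof. by apply: Cext_linear => x dx; apply: Cext_eq0 => y; apply: fl. Qed.

Let gr c : linear (g c).
Proof. by move=> a d d'; apply: Cext_comb => x; apply: Cext_linear (fr x) a d d'. Qed.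

Lemma tens_lift_Cext_linear : linear (tens_lift g).
Proof. exact: tens_lift_linear. Qed.

Lemma tens_lift_Cext_cls x y : tens_lift g (tens (cls k x) (cls k y)) = f x y.
Proof.
rewrite tens_liftE // /g Cext_cls; first by rewrite Cext_cls //; apply: fr.
by move=> x' dx; apply: Cext_eq0 => y'; apply: fl.
Qed.
End Bilinear.
End ChainMaps.

(** * Shuffles of monotone vertex sequences *)

Section Dups.
Variable V : eqType.
Implicit Types (t : seq bool).

(** At each step the entry of t tells whether to stay at the current vertex or to move
    to the next one. *)
Fixpoint dups t (l : seq V) : seq V :=
  match t, l with
  | b :: t', x :: l' => x :: dups t' (if b then l else l')
  | _, _ => l
  end.

Lemma size_dups t x l : count negb t = size l -> size (dups t (x :: l)) = (size t).+1.
Proof.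
elim: t x l => [|[] t IHt] x l /=; first by case: l.
  by rewrite add0n => tl; rewrite IHt.
by case: l => [|y l] //=; rewrite add1n => -[tl]; rewrite IHt.
Qed.

Lemma dups_cat t x l r : count negb t = size l ->
  dups t ((x :: l) ++ r) = dups t (x :: l) ++ r.
Proof.
elim: t x l => [|[] t IHt] x l /=; first by case: l.
  by rewrite add0n => tl; rewrite -cat_cons IHt.
by case: l => [|y l] //=; rewrite add1n => -[tl]; rewrite -cat_cons IHt.
Qed.

Lemma last_dups t x l : count negb t = size l ->
  exists s, dups t (x :: l) = rcons s (last x l).
Proof.
elim: t x l => [|[] t IHt] x l /=; first by case: l => // _; exists [::].
  by rewrite add0n => /(IHt x)[s ->]; exists (x :: s).
by case: l => [|y l] //=; rewrite add1n => -[/(IHt y)[s ->]]; exists (x :: s).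
Qed.

Definition merge2 (m : V -> V -> V) a b := [seq m p.1 p.2 | p <- zip a b].

(** A path is determined by the set of those of its steps that move the first
    coordinate; the second coordinate stays during these steps and moves during the
    others. *)
Lemma shsum_subset_shsum (k : comPzRingType) (M : lmodType k) m (f : seq V -> M) x a y b :
  shsum m f (x :: a) (y :: b) = subset_shsum (size a + size b) (size a)
    (fun t => f (merge2 m (dups (map negb t) (x :: a)) (dups t (y :: b)))).
Proof.
elim: a x y b f => [|x' a IHa] x y b f.
  elim: b y f => [|y' b IHb] y f; rewrite shsum_cons shsum0l /=.
    by rewrite shsum0r scaler0 !addr0 subset_shsum0.
  by rewrite add0n subset_shsumS addr0 IHb.
elim: b y f => [|y' b IHb] y f; rewrite shsum_cons /= add0r addSn subset_shsumS IHa; congr (_ + _).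
  by rewrite shsum0r scaler0 subset_shsum_gt ?scaler0 // addn0.
by rewrite IHb addSnnS.
Qed.
End Dups.

Section Valid.
Variables (V : eqType) (le : rel V) (N : V).
Hypotheses (lexx : reflexive le) (le_trans : transitive le).

(** The sequences that describe monotone maps into the simplex with last vertex N;
    only these define simplices. *)
Definition valid (w : seq V) := [&& w != [::], sorted le w & all (le^~ N) w].

Lemma valid_subseq w' w : w' != [::] -> subseq w' w -> valid w -> valid w'.
Proof.
rewrite /valid => -> ww /and3P[_ sw /allP aw]; rewrite (subseq_sorted le_trans ww sw).
by apply/allP => x /(mem_subseq ww) /aw.
Qed.

Lemma valid_del u x v : valid (u ++ x :: v) -> u ++ v != [::] -> valid (u ++ v).
Proof.
move=> vw uv; apply: valid_subseq vw => //.
by apply: cat_subseq => //; apply: subseq_cons.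
Qed.

Lemma valid_dup u x v : valid (u ++ x :: v) -> valid (u ++ x :: x :: v).
Proof.
case/and3P=> _ sw; rewrite all_cat /= => /and3P[au ax av]; apply/and3P; split.
- by case: u {sw au}.
- case: u sw {au} => [|y u] /=; first by rewrite lexx.
  by rewrite !cat_path /= lexx => /and3P[-> -> ->].
- by rewrite all_cat /= au ax av.
Qed.

Lemma valid_catl u v : u != [::] -> valid (u ++ v) -> valid u.
Proof. by move=> u0; apply: valid_subseq => //; apply: prefix_subseq. Qed.

Lemma valid_catr u v : v != [::] -> valid (u ++ v) -> valid v.
Proof. by move=> v0; apply: valid_subseq => //; apply: suffix_subseq. Qed.

Lemma valid_rcons u x v : valid (u ++ x :: v) -> valid (rcons u x).
Proof. by rewrite -cat_rcons; apply: valid_catl; case: u. Qed.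

Variable m : V -> V -> V.
Hypothesis m_le : forall x x' y y', le x x' -> le y y' -> le (m x y) (m x' y').
Hypothesis mxx : forall x, m x x = x.

Lemma m_leN x y : le x N -> le y N -> le (m x y) N.
Proof. by move=> xN yN; rewrite -[X in le _ X]mxx m_le. Qed.

Lemma valid_shuffles a b p : valid a -> valid b -> p \in shuffles m a b -> valid p.2.
Proof.
suff H : forall a x y b p, path le x a -> path le y b ->
    all (le^~ N) (x :: a) -> all (le^~ N) (y :: b) ->
    p \in shuffles m (x :: a) (y :: b) -> sorted le p.2 && all (le^~ N) p.2.
  case: a b => [|x a] [|y b] // /and3P[_ sa aa] /and3P[_ sb ab] ps.
  have /andP[s1 s2] := H _ _ _ _ _ sa sb aa ab ps.
  by rewrite /valid s1 s2; have [w [-> _ _]] := shufflesP ps.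
clear a b p; elim=> [|x' a IHa] x y b p.
  elim: b y p => [|y' b IHb] y p /=.
    rewrite inE => _ _ /andP[xN _] /andP[yN _] /eqP-> /=.
    by rewrite ?m_leN ?m_le.
  move=> _ /andP[yy' pb] /andP[xN _] /and3P[yN y'N bN] /mapP[q qs -> /=].
  have /andP[] : sorted le q.2 && all (le^~ N) q.2
    by apply: IHb qs; rewrite //= ?xN ?y'N.
  have [w [-> _ _]] := shufflesP (qs : q \in shuffles m [:: x] (y' :: b)) => /= -> -> /=.
  by rewrite ?m_leN ?m_le.
move=> /= /andP[xx' pa]; elim: b y p => [|y' b IHb] y p.
  move=> _ /and3P[xN x'N aN] /andP[yN _]; rewrite /= cats0 => /mapP[q qs -> /=].
  have /andP[] : sorted le q.2 && all (le^~ N) q.2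
    by apply: IHa qs; rewrite //= ?x'N ?yN.
  have [w [-> _ _]] := shufflesP (qs : q \in shuffles m (x' :: a) [:: y]) => /= -> -> /=.
  by rewrite ?m_leN ?m_le.
move=> /= /andP[yy' pb] /and3P[xN x'N aN] /and3P[yN y'N bN].
rewrite mem_cat => /orP[] /mapP[q qs -> /=].
  have /andP[] : sorted le q.2 && all (le^~ N) q.2
    by apply: IHa qs; rewrite //= ?yy' ?x'N ?yN ?y'N.
  have [w [-> _ _]] := shufflesP (qs : q \in shuffles m (x' :: a) (y :: y' :: b)) => /= -> -> /=.
  by rewrite ?m_leN ?m_le.
have /andP[] : sorted le q.2 && all (le^~ N) q.2
    by apply: IHb qs; rewrite //= ?xN ?x'N ?y'N.
have [w [-> _ _]] := shufflesP (qs : q \in shuffles m (x :: x' :: a) (y' :: b)) => /= -> -> /=.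
by rewrite ?m_leN ?m_le.
Qed.

Variables (k : comPzRingType) (M : lmodType k).
Implicit Types f g : seq V -> M.

Lemma eq_shsum_valid f g a b : valid a -> valid b ->
  (forall w, valid w -> f w = g w) -> shsum m f a b = shsum m g a b.
Proof.
move=> va vb fg; rewrite /shsum !big_seq; apply: eq_bigr => p ps.
by rewrite fg //; apply: valid_shuffles ps.
Qed.

Lemma eq_Fpath_valid f g w : valid w ->
  (forall t, valid t -> f t = g t) -> Fpath m f w = Fpath m g w.
Proof.
move=> vw fg; apply: eq_cutsum => u x v ew; rewrite ew in vw.
by apply: eq_shsum_valid => //; [apply: valid_rcons vw | apply: valid_catr vw].
Qed.

(** A path over two consecutive pieces of a monotone sequence ends below the last
    vertex of the second piece, so it can be continued by the rest of the sequence. *)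
Lemma eq_shsum_tail_valid f g u1 y u2 v :
  let x := last y u2 in
  valid (u1 ++ y :: u2 ++ v) -> (forall t, valid t -> f t = g t) ->
  shsum m (fun t => f (t ++ x :: v)) (rcons u1 y) (y :: u2) =
  shsum m (fun t => g (t ++ x :: v)) (rcons u1 y) (y :: u2).
Proof.
move=> x vw fg; rewrite /shsum !big_seq; apply: eq_bigr => p ps; congr (_ *: _).
have vu1 : valid (rcons u1 y) by move: vw; apply: valid_rcons.
have vyv : valid (y :: u2 ++ v) by apply: valid_catr vw.
have vu2 : valid (y :: u2) by apply: (@valid_catl (y :: u2) v).
have vxv : valid (x :: v).
  by apply: (@valid_catr (belast y u2)); rewrite // -cat_rcons -lastI.
apply: fg; have vp := valid_shuffles vu1 vu2 ps.
have yx : le y x.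
  case/and3P: vu2 => _ /= py _; rewrite /x; case: u2 py {ps vw vyv vxv x} => //= z u2 py.
  have /allP := order_path_min le_trans (py : path le y (z :: u2)); apply; exact: mem_last.
case eu1: (rcons u1 y) ps => [|a0 a] ps; first by case: (u1) eu1.
have ly : last a0 a = y by rewrite -(last_cons a0) -eu1 last_rcons.
have [w [ep _ lw]] := shufflesP ps; rewrite ep in vp *.
case/and3P: vp => _ /= pw aw; case/and3P: vxv => _ /= pv av.
apply/and3P; split=> //; last by rewrite /= in aw *; rewrite all_cat andbA aw.
by rewrite /= cat_path pw /= pv lw ly andbT -/x -[X in le _ X]mxx m_le.
Qed.

Lemma eq_Hpath_valid f g w : valid w ->
  (forall t, valid t -> f t = g t) -> Hpath m f w = Hpath m g w.
Proof.
move=> vw fg; apply: eq_cutsum => u x v ew; congr (_ *: _); apply: eq_cutsum => u1 y u2 eu.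
have ex : x = last y u2 by rewrite -(last_rcons y u x) eu last_cat.
rewrite {1 2}ex; apply: eq_shsum_tail_valid => //.
by rewrite -cat_cons catA -eu cat_rcons -ew.
Qed.
End Valid.

(** * Realizing vertex sequences as simplices *)

Section ProductSimplices.
Variables X Y : sset.
Implicit Types (u : simplex (sprod X Y)).

Lemma sfst_sface i u : sfst (sface i u) = sface i (sfst u).
Proof. by case: u => [[|n] [x y]]. Qed.
Lemma ssnd_sface i u : ssnd (sface i u) = sface i (ssnd u).
Proof. by case: u => [[|n] [x y]]. Qed.
Lemma sfst_sdegen i u : sfst (sdegen i u) = sdegen i (sfst u). Proof. by []. Qed.
Lemma ssnd_sdegen i u : ssnd (sdegen i u) = sdegen i (ssnd u). Proof. by []. Qed.

(** The simplex d is a default value for simplices s and t of different dimensions. *)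
Definition spair (d : simplex (sprod X Y)) (s : simplex X) (t : simplex Y) : simplex (sprod X Y) :=
  untag d (fun y : Y (tag s) => @smk (sprod X Y) (tag s) (tagged s, y)) t.

Lemma spairK d s t : tag s = tag t -> sfst (spair d s t) = s /\ ssnd (spair d s t) = t.
Proof.
case: s t => n x [n' y] /= e; subst n'; rewrite /spair /untag /=.
by case: eqP => // e; rewrite eq_axiomK.
Qed.

Lemma spair_eta d u : spair d (sfst u) (ssnd u) = u.
Proof. by case: u => n [x y]; rewrite /spair /untag /=; case: eqP => // e; rewrite eq_axiomK. Qed.

Lemma sprod_inj u v : sfst u = sfst v -> ssnd u = ssnd v -> u = v.
Proof. by move=> e1 e2; rewrite -(spair_eta u u) -(spair_eta u v) e1 e2. Qed.
End ProductSimplices.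

Section Realization.
Variables (V : eqType) (le : rel V) (N : V).
Hypotheses (lexx : reflexive le) (le_trans : transitive le).
Notation valid := (valid le N).

(** This is how a fixed simplex pulled back along the monotone map w behaves: a
    repetition of a vertex is a degeneracy, an omission is a face. *)
Definition realizes X (phi : seq V -> simplex X) := forall u x v, valid (u ++ x :: v) ->
  [/\ tag (phi (u ++ x :: v)) = (size u + size v)%N,
      sdegen (size u) (phi (u ++ x :: v)) = phi (u ++ x :: x :: v)
    & u ++ v != [::] -> sface (size u) (phi (u ++ x :: v)) = phi (u ++ v)].

Lemma realizes_act X (s : simplex X) (p : V -> nat) :
  (forall x y, le x y -> (p x <= p y)%N) -> p N = tag s ->
  realizes (fun w => act (map p w) s).
Proof.
move=> p_le pN u x v vw.
have good w : valid w -> (map p w != [::]) && inrange 0 (tag s).+1 (map p w).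
  case/and3P=> w0 sw aw; apply/andP; split; first by case: w w0 {sw aw}.
  rewrite /inrange sorted_map (sub_sorted _ sw) //=.
  by rewrite all_map; apply: sub_all aw => y /= /p_le; rewrite pN add0n ltnS.
have gw := good _ vw; rewrite map_cat /= in gw.
split=> [||nuv]; rewrite !map_cat /= ?tag_act //.
- by rewrite size_cat /= addnS !size_map.
- by rewrite -(size_map p u) sdegen_act.
by rewrite -(size_map p u) sface_act // -map_cat; case: (u ++ v) nuv.
Qed.

Lemma realizes_tag X (phi : seq V -> simplex X) w :
  realizes phi -> valid w -> tag (phi w) = (size w).-1.
Proof. by move=> rphi; case: w => // x v /(rphi [::] x v)[]. Qed.

Lemma realizes_spair X Y (d : simplex (sprod X Y)) phi psi :
  realizes phi -> realizes psi -> realizes (fun w => spair d (phi w) (psi w)).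
Proof.
move=> rphi rpsi.
have K w : valid w ->
    sfst (spair d (phi w) (psi w)) = phi w /\ ssnd (spair d (phi w) (psi w)) = psi w.
  by move=> vw; apply: spairK; rewrite !realizes_tag.
move=> u x v vw; have [KX K2] := K _ vw.
have [t1 s1 f1] := rphi _ _ _ vw; have [t2 s2 f2] := rpsi _ _ _ vw.
split=> [||uv].
- by rewrite -t1 -[in RHS]KX.
- have [L1 L2] := K _ (valid_dup lexx vw).
  by apply: sprod_inj; rewrite ?L1 ?L2 ?sfst_sdegen ?ssnd_sdegen ?KX ?K2.
- have [L1 L2] := K _ (valid_del le_trans vw uv).
  by apply: sprod_inj; rewrite ?L1 ?L2 ?sfst_sface ?ssnd_sface ?KX ?K2 ?f1 ?f2.
Qed.

Section Operators.
Variables (X : sset) (phi : seq V -> simplex X).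
Hypothesis rphi : realizes phi.

Lemma faces_realizes u v w : valid (u ++ v ++ w) -> u ++ w != [::] ->
  faces (size u) (size u + size v) (phi (u ++ v ++ w)) = phi (u ++ w).
Proof.
rewrite /faces addKn => vw uw; elim: v u vw uw => [|x v IHv] u vw uw //=.
have vw' : valid (u ++ x :: w).
  apply: valid_subseq vw => //; first by case: (u).
  rewrite cat_subseq //= eqxx; exact: suffix_subseq.
have [_ _ <- //] := rphi vw'; congr sface.
rewrite -cat_rcons -(size_rcons u x) -[u ++ x :: w]cat_rcons; apply: IHv.
  by rewrite cat_rcons.
by case: (u).
Qed.

Definition degen_mask t (s : simplex X) :=
  foldl (fun v i => sdegen i v) s (mask t (iota 0 (size t))).

Lemma degens_degen_mask n (A : {set 'I_n}) s : degens A s = degen_mask (set_mask A) s.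
Proof.
rewrite /degens /degen_mask size_set_mask -enum_set_mask.
by elim: (enum A) s => //= i e IHe s; rewrite IHe.
Qed.

Lemma degen_mask_realizes t x l : valid (x :: l) -> (count negb t <= size l)%N ->
  degen_mask t (phi (x :: l)) = phi (dups t (x :: l)) /\ valid (dups t (x :: l)).
Proof.
suff H : forall t u x l, valid (u ++ x :: l) -> (count negb t <= size l)%N ->
    foldl (fun v i => sdegen i v) (phi (u ++ x :: l)) (mask t (iota (size u) (size t))) =
    phi (u ++ dups t (x :: l)) /\ valid (u ++ dups t (x :: l)).
  by apply: (H t [::]).
clear t x l; elim=> [|b t IHt] u x l vw; first by split.
case: b => /= tl.
  have [_ -> _] := rphi vw; have := IHt (rcons u x) x l.
  by rewrite !cat_rcons size_rcons; apply=> //; apply: valid_dup.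
case: l vw tl => [|y l] // vw tl; have := IHt (rcons u x) y l.
by rewrite !cat_rcons size_rcons; apply.
Qed.
End Operators.
End Realization.

(** * The Eilenberg-Zilber maps on realized sequences *)

Lemma simplex_pair X Y (s : simplex X) (t : simplex Y) : tag s = tag t ->
  exists2 z : simplex (sprod X Y), sfst z = s & ssnd z = t.
Proof.
case: s t => n x [n' y] /= e; subst n'.
by exists (@smk (sprod X Y) n (x, y)).
Qed.

Lemma sdegen_degenerate X i (s : simplex X) : degenerate (sdegen i s).
Proof. by case: s => n x; exists n, (inord i), x. Qed.

Lemma seq_split_at (V : eqType) (w : seq V) j : (j < size w)%N ->
  exists w1 x w2, w = w1 ++ x :: w2 /\ size w1 = j.
Proof.
elim: j w => [|j IHj] [|x w] //=; first by exists [::], x, w.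
by rewrite ltnS => /IHj[w1 [y [w2 [-> <-]]]]; exists (x :: w1), y, w2.
Qed.

Section Triangle.
Variables (M : zmodType) (h : nat -> nat -> M).

(** Reindexing by j = p + q + 1; the cuts i = j of the left-hand side have no
    counterpart on the right. *)
Lemma sum_triangle n : (forall j, (j <= n)%N -> h j j = 0) ->
  \sum_(j < n.+1) \sum_(i < j.+1) h i j =
  \sum_(p < n) \sum_(q < n | (p + q < n)%N) h p (p + q).+1.
Proof.
move=> h0; rewrite big_ord_recl big_ord1 h0 // add0r.
transitivity (\sum_(j < n) \sum_(p < n | (p <= j)%N) h p j.+1).
  apply: eq_bigr => j _; rewrite big_ord_recr /= h0 // addr0.
  by rewrite (big_ord_widen n (fun p => h p j.+1)).
rewrite (exchange_big_dep predT) //=; apply: eq_bigr => p _.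
rewrite -(big_mkord (fun j => p <= j)%N (fun j => h p j.+1)).
rewrite -(big_mkord (fun q => p + q < n)%N (fun q => h p (p + q).+1)).
transitivity (\sum_(p <= j < n) h p j.+1).
  by rewrite (big_nat_widenl p 0%N).
rewrite -{1}[p : nat]add0n big_addn (big_nat_widen _ _ n) ?leq_subr //.
rewrite big_nat_cond [RHS]big_nat_cond.
by apply: eq_big => [q|q _]; rewrite ?ltn_subRL // addnC.
Qed.
End Triangle.

Section Bridge.
Variables (k : comPzRingType) (X Y : sset).

Lemma nabla_splxE (s : simplex X) (t : simplex Y) : nabla_splx k s t =
  subset_shsum (tag s + tag t) (tag s)
    (fun q => cpair k (degen_mask (map negb q) s) (degen_mask q t)).
Proof. by apply: eq_bigr => A _; rewrite !degens_degen_mask set_maskC. Qed.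

Definition AW_splx (u : simplex (sprod X Y)) : tensor (C k X) (C k Y) :=
  \sum_(i < (tag u).+1)
    tens (cls k (faces i.+1 (tag u).+1 (sfst u))) (cls k (faces 0 i (ssnd u))).

Definition tildeH_splx (u : simplex (sprod X Y)) : C k (sprod X Y) :=
  \sum_(p < tag u) \sum_(q < tag u | (p + q < tag u)%N)
    \sum_(A : {set 'I_(p + q.+1)} | #|A| == p)
      (-1) ^+ (p + q + odd_perm (shuffle_perm A)) *:
        cpair k (degens (~: A) (faces p.+1 (p + q).+1 (sfst u)))
                (sdegen (p + q).+1 (degens A (faces 0 p (ssnd u)))).

Variables (V : eqType) (le : rel V) (N : V).
Hypotheses (lexx : reflexive le) (le_trans : transitive le).
Variable m : V -> V -> V.
Hypothesis m_le : forall x x' y y', le x x' -> le y y' -> le (m x y) (m x' y').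
Hypothesis mxx : forall x, m x x = x.
Notation valid := (valid le N).
Variables (phi : seq V -> simplex X) (psi : seq V -> simplex Y).
Hypotheses (rphi : realizes le N phi) (rpsi : realizes le N psi).
Hypothesis phim : forall a b, size a = size b -> phi (merge2 m a b) = phi a.
Hypothesis psim : forall a b, size a = size b -> psi (merge2 m a b) = psi b.

Let f0 w := cpair k (phi w) (psi w).
(** The value 0 on sequences that are not monotone makes this a normalized function on
    all sequences. *)
Definition path_chain w : C k (sprod X Y) := if valid w then f0 w else 0.
Let f := path_chain.

Lemma path_chainE w : valid w -> f w = f0 w.
Proof. by rewrite /f /path_chain => ->. Qed.

Lemma normalized_path_chain : normalized id f.
Proof.
move=> w /stuttersP[u [x [y [v [-> /= <-]]]]]; rewrite /f /path_chain; case: ifP => // vw.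
have vw' : valid (u ++ x :: v) by apply: (valid_del le_trans vw); case: (u).
have [t1 s1 _] := rphi vw'; have [t2 s2 _] := rpsi vw'.
have [z z1 z2] := simplex_pair (etrans t1 (esym t2)).
rewrite /f0 -s1 -s2 -z1 -z2 -sfst_sdegen -ssnd_sdegen cpairE.
by apply: cls_degenerate; apply: sdegen_degenerate.
Qed.

Lemma count_negb t : (count negb t + count id t)%N = size t.
Proof. by rewrite -(count_predC negb); congr (_ + _)%N; apply: eq_count => -[]. Qed.

Lemma count_map_negb t : count negb (map negb t) = count id t.
Proof. by rewrite count_map; apply: eq_count => -[]. Qed.

Lemma nabla_splx_realizes x a y b : valid (x :: a) -> valid (y :: b) ->
  nabla_splx k (phi (x :: a)) (psi (y :: b)) = shsum m f0 (x :: a) (y :: b).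
Proof.
move=> va vb; rewrite nabla_splxE shsum_subset_shsum.
rewrite (realizes_tag rphi va) (realizes_tag rpsi vb) /=.
apply: eq_subset_shsum => t st ct; have cn := count_negb t.
have ca : count negb (map negb t) = size a by rewrite count_map_negb.
have cb : count negb t = size b by lia.
have [-> _] := degen_mask_realizes lexx rphi va (eq_leq ca).
have [-> _] := degen_mask_realizes lexx rpsi vb (eq_leq cb).
have sz : size (dups (map negb t) (x :: a)) = size (dups t (y :: b)).
  by rewrite !size_dups // size_map.
by rewrite /f0 phim // psim.
Qed.

Lemma merge2_cat a b c : size a = size b -> merge2 m (a ++ c) (b ++ c) = merge2 m a b ++ c.
Proof.
move=> ab; rewrite /merge2 zip_cat // map_cat; congr (_ ++ _).
by elim: c => //= z c ->; rewrite mxx.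
Qed.

(** The faces of the first factor remove the vertices of w2, so that after the shuffle
    the first coordinate jumps from x to y.  The additional degeneracy of the second
    factor repeats its vertex y during the jump. *)
Lemma tildeH_term_realizes w1 x w2 y w3 :
  let w := w1 ++ x :: w2 ++ y :: w3 in
  let p := size w1 in let q := size w2 in
  valid w ->
  \sum_(A : {set 'I_(p + q.+1)} | #|A| == p)
      (-1) ^+ (p + q + odd_perm (shuffle_perm A)) *:
        cpair k (degens (~: A) (faces p.+1 (p + q).+1 (phi w)))
                (sdegen (p + q).+1 (degens A (faces 0 p (psi w)))) =
  (-1) ^+ (p + q) *: shsum m (fun t => f0 (t ++ y :: w3)) (rcons w1 x) (x :: rcons w2 y).
Proof.
move=> w p q vw.
have -> : faces p.+1 (p + q).+1 (phi w) = phi (rcons w1 x ++ y :: w3).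
  rewrite -addSn /p /q -(size_rcons w1 x) /w -cat_rcons (faces_realizes le_trans rphi) //.
    by rewrite cat_rcons.
  by case: (w1).
have -> : faces 0 p (psi w) = psi (x :: rcons w2 y ++ w3).
  by rewrite cat_rcons /w /p; apply: (@faces_realizes _ _ _ le_trans _ _ rpsi [::] w1).
have vx : valid (rcons w1 x ++ y :: w3).
  apply: valid_subseq vw => //; first by case: (w1).
  by rewrite /w -(cat_rcons x w1) cat_subseq // suffix_subseq.
have vy : valid (x :: rcons w2 y ++ w3).
  by rewrite cat_rcons; apply: (@valid_catr _ _ _ le_trans w1).
case ew1: (rcons w1 x) vx => [|x0 l0]; first by case: (w1) ew1.
have sl0 : size l0 = p by apply: succn_inj; rewrite -[LHS]/(size (x0 :: l0)) -ew1 size_rcons.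
rewrite cat_cons => vx; rewrite shsum_subset_shsum sl0 size_rcons.
under eq_bigr => A _ do rewrite exprD -scalerA.
rewrite -scaler_sumr; congr (_ *: _).
under eq_bigr => A _ do rewrite !degens_degen_mask set_maskC.
apply: (@eq_subset_shsum _ _ _ _ (fun t =>
    cpair k (degen_mask (map negb t) (phi (x0 :: l0 ++ y :: w3)))
      (sdegen (p + q).+1 (degen_mask t (psi (x :: rcons w2 y ++ w3)))))) => t st ct.
have cn := count_negb t.
have ca : count negb (map negb t) = size l0 by rewrite count_map_negb sl0.
have cb : count negb t = size (rcons w2 y) by rewrite size_rcons; lia.
have [|-> _] := degen_mask_realizes lexx rphi vx (t := map negb t).
  by rewrite ca size_cat leq_addr.
have [|-> vd] := degen_mask_realizes lexx rpsi vy (t := t).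
  by rewrite cb size_cat leq_addr.
rewrite -!cat_cons !dups_cat // in vd *.
have [s es] := last_dups x cb; rewrite last_rcons in es.
have ss : size s = (p + q).+1.
  by apply: succn_inj; rewrite -(size_rcons s y) -es size_dups // st addnS.
rewrite -ss; have -> : sdegen (size s) (psi (dups t (x :: rcons w2 y) ++ w3)) =
   psi (dups t (x :: rcons w2 y) ++ y :: w3).
  by rewrite es !cat_rcons in vd *; have [_ -> _] := rpsi vd.
have sz : size (dups (map negb t) (x0 :: l0)) = size (dups t (x :: rcons w2 y)).
  by rewrite !size_dups // size_map.
by rewrite /f0 -merge2_cat // phim ?psim // !size_cat sz.
Qed.

Lemma tildeH_splx_realizes u w : valid w -> sfst u = phi w -> ssnd u = psi w ->
  tildeH_splx u = Hpath m f w.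
Proof.
move=> vw u1 u2; have tu : tag u = (size w).-1 by rewrite -(realizes_tag rphi vw) -u1.
pose h i j := (-1) ^+ j.+1 *:
  shsum m (fun t => f (t ++ drop j w)) (take i.+1 w) (drop i (take j.+1 w)).
have sw : size w = (tag u).+1 by rewrite tu; case: (w) vw.
transitivity (\sum_(j < (tag u).+1) \sum_(i < j.+1) h i j); last first.
  rewrite /Hpath /cutsum sw; apply: eq_bigr => j _.
  have sj : size (take j.+1 w) = j.+1 by rewrite size_takel // sw.
  rewrite /Fpath /cutsum sj scaler_sumr; apply: eq_bigr => i _.
  by rewrite take_takel //; have := ltn_ord i; lia.
rewrite sum_triangle; last first.
  move=> j jn; rewrite /h.
  have [|w1 [x [w3 [ew <-]]]] := @seq_split_at V w j; first by rewrite sw.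
  rewrite ew -{2 3}cat_rcons -(size_rcons w1 x) !take_size_cat // size_rcons.
  rewrite drop_size_cat // -cats1 drop_size_cat // shsum1r cats1.
  case e: (rcons w1 x) => [|x0 l0]; first by rewrite scaler0.
  rewrite -e map_rcons mxx normalized_path_chain ?scaler0 //.
  exact: stutters_join.
apply: eq_bigr => p _; apply: eq_bigr => q pq.
have [|w1 [x [w' [ew sw1]]]] := @seq_split_at V w p; first by rewrite sw leqW.
have [|w2 [y [w3 [ew' sw2]]]] := @seq_split_at V w' q.
  move: sw pq; rewrite ew size_cat /= sw1.
  by move: (size w') (tag u) (nat_of_ord p) (nat_of_ord q) => a b c d; lia.
rewrite {}ew' in ew; have /= := @tildeH_term_realizes w1 x w2 y w3.
rewrite -ew sw1 sw2 u1 u2 => -> //; rewrite /h -sw1 -sw2.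
rewrite !exprS !mulN1r opprK.
have -> : take (size w1).+1 w = rcons w1 x.
  by rewrite ew -cat_rcons -(size_rcons w1 x) take_size_cat.
have e2 : w = (w1 ++ x :: w2) ++ y :: w3 by rewrite ew -catA.
have s2 : size (w1 ++ x :: w2) = (size w1 + size w2).+1 by rewrite size_cat addnS.
have -> : drop (size w1 + size w2).+1 w = y :: w3 by rewrite e2 -s2 drop_size_cat.
have -> : take (size w1 + size w2).+2 w = w1 ++ x :: rcons w2 y.
  by rewrite e2 -cat_rcons -s2 -(size_rcons _ y) take_size_cat // rcons_cat.
rewrite drop_size_cat //; congr (_ *: _).
have := eq_shsum_tail_valid lexx le_trans m_le mxx (N := N) (f := f0) (g := f)
  (u1 := w1) (y := x) (u2 := rcons w2 y) (v := w3).
by rewrite /= last_rcons cat_rcons -ew; apply=> // t /path_chainE ->.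
Qed.

Lemma tildeH_splx_degenerate u w :
  valid w -> stutters id w -> sfst u = phi w -> ssnd u = psi w -> tildeH_splx u = 0.
Proof.
move=> vw rw u1 u2; rewrite (tildeH_splx_realizes vw u1 u2).
by apply: Hpath_stutters rw; apply: normalized_path_chain.
Qed.

(** A repetition in a or b becomes a repetition in every path. *)
Lemma nabla_splx_degenerate a b : valid a -> valid b -> stutters id a || stutters id b ->
  nabla_splx k (phi a) (psi b) = 0.
Proof.
case: a b => [|x a] [|y b] // va vb rab; rewrite nabla_splx_realizes //.
rewrite (eq_shsum_valid lexx m_le mxx va vb (g := f)); last by move=> t /path_chainE ->.
case/orP: rab => [ra|rb].
  apply: (shsum_stutterl (q := id) (q' := id)) ra => [? ? ? /= -> //|].
  exact: normalized_path_chain.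
apply: (shsum_stutterr (q := id) (q' := id)) rb => [? ? ? /= -> //|].
exact: normalized_path_chain.
Qed.

Lemma realizes_degenerate Z (chi : seq V -> simplex Z) w :
  realizes le N chi -> valid w -> stutters id w -> degenerate (chi w).
Proof.
move=> rchi vw /stuttersP[u [x [y [v [ew /= exy]]]]]; rewrite ew -{}exy in vw *.
have [|_ <- _] := rchi u x v; last exact: sdegen_degenerate.
by apply: (valid_del le_trans vw); case: (u).
Qed.

Lemma AW_splx_realizes u w : valid w -> sfst u = phi w -> ssnd u = psi w ->
  AW_splx u = cutsum (fun a b => tens (cls k (phi a)) (cls k (psi b))) w.
Proof.
move=> vw u1 u2; have tu : tag u = (size w).-1 by rewrite -(realizes_tag rphi vw) -u1.
have sw : size w = (tag u).+1 by rewrite tu; case: (w) vw.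
rewrite /AW_splx /cutsum sw u1 u2; apply: eq_bigr => -[i iu] _ /=.
have [|w1 [x [w2 [ew sw1]]]] := @seq_split_at V w i; first by rewrite sw.
have -> : faces i.+1 (tag u).+1 (phi w) = phi (take i.+1 w).
  have -> : take i.+1 w = rcons w1 x.
    by rewrite ew -cat_rcons -sw1 -(size_rcons w1 x) take_size_cat.
  have := @faces_realizes _ _ _ le_trans _ _ rphi (rcons w1 x) w2 [::].
  rewrite !cats0 cat_rcons -ew size_rcons addSn sw1 => <- //; last by case: (w1).
  have -> // : (tag u).+1 = (i + size w2).+1.
  by rewrite -sw1 -addnS -[(size w2).+1]/(size (x :: w2)) -size_cat -ew sw.
have -> // : faces 0 i (psi w) = psi (drop i w).
rewrite ew -sw1 drop_size_cat //; rewrite ew in vw.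
exact: (@faces_realizes _ _ _ le_trans _ _ rpsi [::] w1).
Qed.

Lemma AW_splx_degenerate u w :
  valid w -> stutters id w -> sfst u = phi w -> ssnd u = psi w -> AW_splx u = 0.
Proof.
move=> vw rw u1 u2; rewrite (AW_splx_realizes vw u1 u2).
transitivity (cutsum (fun _ _ : seq V => 0 : tensor (C k X) (C k Y)) w).
  2: by rewrite /cutsum big1.
apply: eq_cutsum => a x b ew; rewrite ew in vw rw.
move: rw; rewrite stutters_split => /orP[ra|rb].
  rewrite (cls_degenerate k (u := phi _)) ?tens0l //.
  by apply: realizes_degenerate => //; apply: valid_rcons vw.
rewrite (cls_degenerate k (u := psi _)) ?tens0r //.
by apply: realizes_degenerate => //; apply: valid_catr vw.
Qed.
End Bridge.

(** * Three factors *)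

Section LinearPush.
Variables (k : comPzRingType) (V : eqType) (M M' : lmodType k) (g : {linear M -> M'}).

Lemma linear_Fpath m (f : seq V -> M) w : g (Fpath m f w) = Fpath m (fun t => g (f t)) w.
Proof.
rewrite /Fpath /cutsum linear_sum; apply: eq_bigr => i _; rewrite /shsum linear_sum.
by apply: eq_bigr => p _; rewrite linearZ.
Qed.

Lemma linear_Hpath m (f : seq V -> M) w : g (Hpath m f w) = Hpath m (fun t => g (f t)) w.
Proof.
rewrite /Hpath /cutsum linear_sum; apply: eq_bigr => i _; rewrite linearZ /=.
by rewrite linear_Fpath.
Qed.
End LinearPush.

Definition vertex : Type := (nat * nat * nat)%type.
HB.instance Definition _ := Equality.on vertex.

Definition le_vertex (x y : vertex) := [&& (x.1.1 <= y.1.1)%N, (x.1.2 <= y.1.2)%N & (x.2 <= y.2)%N].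
Definition mixX (x y : vertex) : vertex := (x.1.1, y.1.2, y.2).
Definition mixZ (x y : vertex) : vertex := (x.1, y.2).

Lemma le_vertex_refl : reflexive le_vertex. Proof. by move=> x; rewrite /le_vertex !leqnn. Qed.
Lemma le_vertex_trans : transitive le_vertex.
Proof. by move=> y x z; rewrite /le_vertex; lia. Qed.
Lemma mixX_le x x' y y' : le_vertex x x' -> le_vertex y y' -> le_vertex (mixX x y) (mixX x' y').
Proof. by rewrite /le_vertex /= => /and3P[-> _ _] /and3P[_ -> ->]. Qed.
Lemma mixZ_le x x' y y' : le_vertex x x' -> le_vertex y y' -> le_vertex (mixZ x y) (mixZ x' y').
Proof. by rewrite /le_vertex /= => /and3P[-> -> _] /and3P[_ _ ->]. Qed.
Lemma mixXxx x : mixX x x = x. Proof. by case: x => -[]. Qed.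
Lemma mixZxx x : mixZ x x = x. Proof. by case: x => -[]. Qed.

Definition xcoord (x : vertex) := x.1.1.
Definition ycoord (x : vertex) := x.1.2.
Definition zcoord (x : vertex) := x.2.

Lemma map_merge2l (V : eqType) (m : V -> V -> V) (K : Type) (c : V -> K) a b :
  (forall x y, c (m x y) = c x) -> size a = size b -> map c (merge2 m a b) = map c a.
Proof.
move=> cm; rewrite /merge2 -map_comp; elim: a b => [|x a IHa] [|y b] //= [ab].
by rewrite cm IHa.
Qed.

Lemma map_merge2r (V : eqType) (m : V -> V -> V) (K : Type) (c : V -> K) a b :
  (forall x y, c (m x y) = c y) -> size a = size b -> map c (merge2 m a b) = map c b.
Proof.
move=> cm; rewrite /merge2 -map_comp; elim: a b => [|x a IHa] [|y b] //= [ab].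
by rewrite cm IHa.
Qed.

Lemma mixX_xcoord x x' y : xcoord x = xcoord x' -> mixX x y = mixX x' y.
Proof. by rewrite /mixX /xcoord => ->. Qed.
Lemma mixZ_zcoord x y y' : zcoord y = zcoord y' -> mixZ x y = mixZ x y'.
Proof. by rewrite /mixZ /zcoord => ->. Qed.

Section Staircase.
Variables (N : vertex) (p : nat -> vertex) (n : nat).
Hypothesis p_le : forall i j, (i <= j)%N -> le_vertex (p i) (p j).
Hypothesis pN : le_vertex (p n) N.

Lemma valid_iota : valid le_vertex N (map p (iota 0 n.+1)).
Proof.
apply/and3P; split=> //.
  by rewrite sorted_map; apply: sub_sorted (iota_sorted 0 n.+1) => i j /p_le.
rewrite all_map; apply/allP => i; rewrite mem_iota add0n ltnS => /andP[_ /p_le].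
by move/le_vertex_trans; apply.
Qed.

Definition iota_dup i := iota 0 i ++ [:: i, i & iota i.+1 (n - i)].

Lemma iota_split i : (i <= n)%N -> iota 0 n.+1 = iota 0 i ++ i :: iota i.+1 (n - i).
Proof. by move=> i_n; rewrite -[in LHS](subnKC i_n) -addnS iotaD. Qed.

Lemma valid_iota_dup i : (i <= n)%N -> valid le_vertex N (map p (iota_dup i)).
Proof.
move=> i_n; rewrite /iota_dup map_cat; apply: (valid_dup le_vertex_refl).
by rewrite -map_cons -map_cat -iota_split //; apply: valid_iota.
Qed.

Lemma stutters_iota_dup i : stutters id (map p (iota_dup i)).
Proof. by rewrite /iota_dup map_cat /= -cat_rcons; apply: stutters_join. Qed.
End Staircase.

Lemma act_iota_dup X (s : simplex X) i : (i <= tag s)%N ->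
  act (iota_dup (tag s) i) s = sdegen i s.
Proof.
move=> i_n; have e := iota_split i_n.
rewrite /iota_dup -sdegen_act; first by rewrite -e act_iota size_iota.
rewrite -e /= /inrange (iota_sorted 0 (tag s).+1) /=.
by apply/allP => j; rewrite mem_iota; lia.
Qed.

Lemma degenerateP X (s : simplex X) : degenerate s ->
  exists i t, (i <= tag t)%N /\ s = sdegen i t.
Proof.
move=> [n [i [x ->]]]; exists (val i), (smk x); split; first by rewrite -ltnS ltn_ord.
by rewrite /sdegen /= inord_val.
Qed.

Section Maps.
Variables (k : comPzRingType) (X Y : sset).

Let realizes_x Z (s : simplex Z) a b :
  realizes le_vertex (tag s, a, b) (fun w => act (map xcoord w) s).
Proof. by apply: (realizes_act (p := xcoord)) => // x y /and3P[]. Qed.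
Let realizes_z Z (s : simplex Z) a b :
  realizes le_vertex (a, b, tag s) (fun w => act (map zcoord w) s).
Proof. by apply: (realizes_act (p := zcoord)) => // x y /and3P[]. Qed.

Let merge_x Z (s : simplex Z) (a b : seq vertex) : size a = size b ->
  act (map xcoord (merge2 mixZ a b)) s = act (map xcoord a) s.
Proof. by move=> ab; rewrite map_merge2l. Qed.
Let merge_z Z (s : simplex Z) (a b : seq vertex) : size a = size b ->
  act (map zcoord (merge2 mixZ a b)) s = act (map zcoord b) s.
Proof. by move=> ab; rewrite map_merge2r. Qed.

(** A degenerate simplex is the image of a sequence with a repetition, here along the
    edge of the grid on which only the first coordinate moves. *)
Lemma nabla_splx_degl t : kills_degenerate ((@nabla_splx k X Y)^~ t).
Proof.
move=> s /degenerateP[i [s0 [is0 ->]]].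
pose a := map (fun j => (j, 0%N, 0%N) : vertex) (iota_dup (tag s0) i).
pose b := map (fun j => (0%N, 0%N, j) : vertex) (iota 0 (tag t).+1).
have ea : act (map xcoord a) s0 = sdegen i s0.
  by rewrite -map_comp (eq_map (_ : _ =1 id)) // map_id act_iota_dup.
have eb : act (map zcoord b) t = t.
  by rewrite -map_comp (eq_map (_ : _ =1 id)) // map_id act_iota.
have := nabla_splx_degenerate k le_vertex_refl le_vertex_trans mixZ_le mixZxx
  (@realizes_x _ s0 0 (tag t)) (@realizes_z _ t (tag s0) 0)
  (@merge_x _ s0) (@merge_z _ t) (a := a) (b := b).
rewrite ea eb; apply.
- by apply: valid_iota_dup => *; rewrite /le_vertex /= ?leqnn ?andbT.
- by apply: valid_iota => *; rewrite /le_vertex /= ?leqnn ?andbT.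
- by rewrite stutters_iota_dup.
Qed.

Lemma nabla_splx_degr s : kills_degenerate (@nabla_splx k X Y s).
Proof.
move=> t /degenerateP[i [t0 [it0 ->]]].
pose a := map (fun j => (j, 0%N, 0%N) : vertex) (iota 0 (tag s).+1).
pose b := map (fun j => (0%N, 0%N, j) : vertex) (iota_dup (tag t0) i).
have ea : act (map xcoord a) s = s.
  by rewrite -map_comp (eq_map (_ : _ =1 id)) // map_id act_iota.
have eb : act (map zcoord b) t0 = sdegen i t0.
  by rewrite -map_comp (eq_map (_ : _ =1 id)) // map_id act_iota_dup.
have := nabla_splx_degenerate k le_vertex_refl le_vertex_trans mixZ_le mixZxx
  (@realizes_x _ s 0 (tag t0)) (@realizes_z _ t0 (tag s) 0)
  (@merge_x _ s) (@merge_z _ t0) (a := a) (b := b).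
rewrite ea eb; apply.
- by apply: valid_iota => *; rewrite /le_vertex /= ?leqnn ?andbT.
- by apply: valid_iota_dup => *; rewrite /le_vertex /= ?leqnn ?andbT.
- by rewrite stutters_iota_dup orbT.
Qed.

Let diag (l : seq nat) := map (fun j => (j, j, j) : vertex) l.
Let x_diag l : map xcoord (diag l) = l.
Proof. by rewrite -map_comp (eq_map (_ : _ =1 id)) // map_id. Qed.
Let z_diag l : map zcoord (diag l) = l.
Proof. by rewrite -map_comp (eq_map (_ : _ =1 id)) // map_id. Qed.

Let valid_diag_dup n i : (i <= n)%N -> valid le_vertex (n, n, n) (diag (iota_dup n i)).
Proof.
by move=> ni; apply: valid_iota_dup => // [j j' jj'|]; rewrite /le_vertex /= ?leqnn ?jj'.
Qed.

Lemma AW_splx_deg : kills_degenerate (@AW_splx k X Y).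
Proof.
move=> _ /degenerateP[i [u [iu ->]]].
apply: (AW_splx_degenerate k le_vertex_trans (@realizes_x _ (sfst u) _ _)
  (@realizes_z _ (ssnd u) _ _) (valid_diag_dup iu)).
- exact: stutters_iota_dup.
- by rewrite x_diag; rewrite [RHS](@act_iota_dup _ (sfst u)).
- by rewrite z_diag; rewrite [RHS](@act_iota_dup _ (ssnd u)).
Qed.

Lemma tildeH_splx_deg : kills_degenerate (@tildeH_splx k X Y).
Proof.
move=> _ /degenerateP[i [u [iu ->]]].
apply: (tildeH_splx_degenerate k le_vertex_refl le_vertex_trans mixZ_le mixZxx
  (@realizes_x _ (sfst u) _ _) (@realizes_z _ (ssnd u) _ _)
  (@merge_x _ _) (@merge_z _ _) (valid_diag_dup iu)).
- exact: stutters_iota_dup.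
- by rewrite x_diag; rewrite [RHS](@act_iota_dup _ (sfst u)).
- by rewrite z_diag; rewrite [RHS](@act_iota_dup _ (ssnd u)).
Qed.

Fact AW_linear : linear (@AW k X Y).
Proof. exact: Cext_linear AW_splx_deg. Qed.
Fact nabla_linear : linear (@nabla k X Y).
Proof. exact: tens_lift_Cext_linear nabla_splx_degl nabla_splx_degr. Qed.
Fact F_linear : linear (@F k X Y).
Proof. by move=> a c d; rewrite /F AW_linear nabla_linear. Qed.
Fact tildeH_linear : linear (@tildeH k X Y).
Proof. exact: Cext_linear tildeH_splx_deg. Qed.
HB.instance Definition _ := GRing.isLinear.Build _ _ _ _ _ nabla_linear.
HB.instance Definition _ := GRing.isLinear.Build _ _ _ _ _ F_linear.
HB.instance Definition _ := GRing.isLinear.Build _ _ _ _ _ tildeH_linear.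

Section OnPaths.
Variables (V : eqType) (le : rel V) (N : V).
Hypotheses (lexx : reflexive le) (le_trans : transitive le).
Variable m : V -> V -> V.
Hypothesis m_le : forall x x' y y', le x x' -> le y y' -> le (m x y) (m x' y').
Hypothesis mxx : forall x, m x x = x.
Variables (phi : seq V -> simplex X) (psi : seq V -> simplex Y).
Hypotheses (rphi : realizes le N phi) (rpsi : realizes le N psi).
Hypothesis phim : forall a b, size a = size b -> phi (merge2 m a b) = phi a.
Hypothesis psim : forall a b, size a = size b -> psi (merge2 m a b) = psi b.
Notation f := (path_chain k le N phi psi).

Lemma F_path_chain w : valid le N w -> F (f w) = Fpath m f w.
Proof.
move=> vw; have tphi := realizes_tag rphi vw; have tpsi := realizes_tag rpsi vw.
have [u u1 u2] := simplex_pair (etrans tphi (esym tpsi)).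
rewrite path_chainE // -u1 -u2 cpairE /F.
have -> : AW (cls k u) = AW_splx k u by apply: Cext_cls; exact: AW_splx_deg.
rewrite (AW_splx_realizes k le_trans rphi rpsi vw u1 u2) /cutsum linear_sum /=.
transitivity (cutsum (fun a b => nabla (tens (cls k (phi a)) (cls k (psi b)))) w) => //.
apply: eq_cutsum => a x b ew; rewrite ew in vw.
have va := valid_rcons le_trans vw.
have vb : valid le N (x :: b) by apply: valid_catr vw.
have -> : nabla (tens (cls k (phi (rcons a x))) (cls k (psi (x :: b)))) =
    nabla_splx k (phi (rcons a x)) (psi (x :: b)).
  by apply: tens_lift_Cext_cls; [exact: nabla_splx_degl | exact: nabla_splx_degr].
case: (rcons a x) va => [//|y a'] va.
rewrite (nabla_splx_realizes k lexx rphi rpsi phim psim va vb).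
by apply: (eq_shsum_valid lexx m_le mxx va vb) => t vt; rewrite path_chainE.
Qed.

Lemma tildeH_path_chain w : valid le N w -> tildeH (f w) = Hpath m f w.
Proof.
move=> vw; have tphi := realizes_tag rphi vw; have tpsi := realizes_tag rpsi vw.
have [u u1 u2] := simplex_pair (etrans tphi (esym tpsi)).
rewrite [in LHS]path_chainE // -u1 -u2 cpairE.
have -> : tildeH (cls k u) = tildeH_splx k u by apply: Cext_cls; exact: tildeH_splx_deg.
exact: (tildeH_splx_realizes k lexx le_trans m_le mxx rphi rpsi phim psim vw u1 u2).
Qed.
End OnPaths.
End Maps.

Section Reassociation.
Variables (k : comPzRingType) (X Y Z : sset).

Definition chain_assoc : C k (sprod (sprod X Y) Z) -> C k (sprod X (sprod Y Z)) :=
  Cext (fun u => cls k (sassoc u)).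
Definition chain_unassoc : C k (sprod X (sprod Y Z)) -> C k (sprod (sprod X Y) Z) :=
  Cext (fun u => cls k (sunassoc u)).

Lemma sassoc_degenerate : kills_degenerate (fun u => cls k (@sassoc X Y Z u)).
Proof.
move=> _ [n [i [x ->]]]; apply: cls_degenerate.
by exists n, i, (tagged (sassoc (smk x))).
Qed.

Lemma sunassoc_degenerate : kills_degenerate (fun u => cls k (@sunassoc X Y Z u)).
Proof.
move=> _ [n [i [x ->]]]; apply: cls_degenerate.
by exists n, i, (tagged (sunassoc (smk x))).
Qed.

Fact chain_assoc_linear : linear chain_assoc.
Proof. exact: Cext_linear sassoc_degenerate. Qed.
Fact chain_unassoc_linear : linear chain_unassoc.
Proof. exact: Cext_linear sunassoc_degenerate. Qed.
HB.instance Definition _ := GRing.isLinear.Build _ _ _ _ _ chain_assoc_linear.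
HB.instance Definition _ := GRing.isLinear.Build _ _ _ _ _ chain_unassoc_linear.

Lemma chain_assoc_cls u : chain_assoc (cls k u) = cls k (sassoc u).
Proof. by apply: Cext_cls; exact: sassoc_degenerate. Qed.
Lemma chain_unassoc_cls u : chain_unassoc (cls k u) = cls k (sunassoc u).
Proof. by apply: Cext_cls; exact: sunassoc_degenerate. Qed.

Fact F_X_YZ_linear : linear (@F_X_YZ k X Y Z).
Proof.
by move=> a c d; exact: (linearP (chain_unassoc \o @F k X (sprod Y Z) \o chain_assoc)).
Qed.
Fact tildeH_X_YZ_linear : linear (@tildeH_X_YZ k X Y Z).
Proof.
by move=> a c d; exact: (linearP (chain_unassoc \o @tildeH k X (sprod Y Z) \o chain_assoc)).
Qed.
HB.instance Definition _ := GRing.isLinear.Build _ _ _ _ _ F_X_YZ_linear.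
HB.instance Definition _ := GRing.isLinear.Build _ _ _ _ _ tildeH_X_YZ_linear.
HB.instance Definition _ := GRing.isLinear.Build _ _ _ _ _
  (@F_linear k (sprod X Y) Z : linear (@F_XY_Z k X Y Z)).
HB.instance Definition _ := GRing.isLinear.Build _ _ _ _ _
  (@tildeH_linear k (sprod X Y) Z : linear (@tildeH_XY_Z k X Y Z)).

Variable u : simplex (sprod (sprod X Y) Z).
Let N : vertex := (tag u, tag u, tag u).
Let phiX (w : seq vertex) := act (map xcoord w) (sfst (sfst u)).
Let phiY (w : seq vertex) := act (map ycoord w) (ssnd (sfst u)).
Let phiZ (w : seq vertex) := act (map zcoord w) (ssnd u).
Let phiXY w := spair (sfst u) (phiX w) (phiY w).
Let phiYZ w := spair (ssnd (sassoc u)) (phiY w) (phiZ w).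

Let rX : realizes le_vertex N phiX.
Proof. by apply: (realizes_act (p := xcoord)) => // x y /and3P[]. Qed.
Let rY : realizes le_vertex N phiY.
Proof. by apply: (realizes_act (p := ycoord)) => // x y /and3P[]. Qed.
Let rZ : realizes le_vertex N phiZ.
Proof. by apply: (realizes_act (p := zcoord)) => // x y /and3P[]. Qed.
Let rXY : realizes le_vertex N phiXY.
Proof. exact: (realizes_spair le_vertex_refl le_vertex_trans). Qed.
Let rYZ : realizes le_vertex N phiYZ.
Proof. exact: (realizes_spair le_vertex_refl le_vertex_trans). Qed.

Let f := path_chain k le_vertex N phiXY phiZ.
Let f' := path_chain k le_vertex N phiX phiYZ.
Let nf : normalized id f.
Proof. exact: (normalized_path_chain k le_vertex_trans rXY rZ). Qed.

Let assoc_f w : chain_assoc (f w) = f' w.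
Proof.
rewrite /f /f' /path_chain; case: ifP => vw; last exact: linear0.
have tX := realizes_tag rX vw; have tY := realizes_tag rY vw; have tZ := realizes_tag rZ vw.
have [XY1 XY2] := spairK (sfst u) (etrans tX (esym tY)).
have [YZ1 YZ2] := spairK (ssnd (sassoc u)) (etrans tY (esym tZ)).
have [z z1 z2] := simplex_pair (etrans (realizes_tag rXY vw) (esym tZ)).
rewrite -{1}z1 -{1}z2 cpairE chain_assoc_cls -cpairE; congr cpair.
  by rewrite -XY1 -/(phiXY w) -z1.
apply: sprod_inj; first by rewrite YZ1 -XY2 -/(phiXY w) -z1.
by rewrite YZ2 -z2.
Qed.

Let unassoc_f w : chain_unassoc (f' w) = f w.
Proof.
rewrite -assoc_f /f /path_chain; case: ifP => vw; last by rewrite !linear0.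
have [z z1 z2] := simplex_pair (etrans (realizes_tag rXY vw) (esym (realizes_tag rZ vw))).
rewrite -z1 -z2 cpairE chain_assoc_cls chain_unassoc_cls.
by case: z {z1 z2} => n [[x y] t].
Qed.

Let F_XY_Zf w : valid le_vertex N w -> F_XY_Z (f w) = Fpath mixZ f w.
Proof.
move=> vw; rewrite /F_XY_Z.
apply: (F_path_chain k le_vertex_refl le_vertex_trans mixZ_le mixZxx rXY rZ) => // a b ab.
  by rewrite /phiXY /phiX /phiY !map_merge2l.
by rewrite /phiZ map_merge2r.
Qed.

Let H_XY_Zf w : valid le_vertex N w -> tildeH_XY_Z (f w) = Hpath mixZ f w.
Proof.
move=> vw; rewrite /tildeH_XY_Z.
apply: (tildeH_path_chain k le_vertex_refl le_vertex_trans mixZ_le mixZxx rXY rZ) => // a b ab.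
  by rewrite /phiXY /phiX /phiY !map_merge2l.
by rewrite /phiZ map_merge2r.
Qed.

Let F_X_YZf w : valid le_vertex N w -> F_X_YZ (f w) = Fpath mixX f w.
Proof.
move=> vw; rewrite /F_X_YZ /reassoc -/(chain_assoc _) -/(chain_unassoc _) assoc_f.
rewrite (F_path_chain k le_vertex_refl le_vertex_trans mixX_le mixXxx rX rYZ) //
  => [|a b ab|a b ab].
- by rewrite linear_Fpath; apply: eq_Fpath => t; apply: unassoc_f.
- by rewrite /phiX map_merge2l.
- by rewrite /phiYZ /phiY /phiZ !map_merge2r.
Qed.

Let H_X_YZf w : valid le_vertex N w -> tildeH_X_YZ (f w) = Hpath mixX f w.
Proof.
move=> vw; rewrite /tildeH_X_YZ /reassoc -/(chain_assoc _) -/(chain_unassoc _) assoc_f.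
rewrite (tildeH_path_chain k le_vertex_refl le_vertex_trans mixX_le mixXxx rX rYZ) //
  => [|a b ab|a b ab].
- by rewrite linear_Hpath; apply: eq_Hpath => t; apply: unassoc_f.
- by rewrite /phiX map_merge2l.
- by rewrite /phiYZ /phiY /phiZ !map_merge2r.
Qed.

Let w0 : seq vertex := map (fun j => (j, j, j)) (iota 0 (tag u).+1).
Let vw0 : valid le_vertex N w0.
Proof. by apply: valid_iota => [j j' jj'|]; rewrite /le_vertex /= ?leqnn ?jj'. Qed.
Let fw0 : f w0 = cls k u.
Proof.
rewrite /f path_chainE // /phiXY /phiX /phiY /phiZ.
have xw0 : map xcoord w0 = iota 0 (tag u).+1 by rewrite -map_comp (eq_map (_ : _ =1 id)) ?map_id.
have yw0 : map ycoord w0 = iota 0 (tag u).+1 by rewrite -map_comp (eq_map (_ : _ =1 id)) ?map_id.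
have zw0 : map zcoord w0 = iota 0 (tag u).+1 by rewrite -map_comp (eq_map (_ : _ =1 id)) ?map_id.
rewrite xw0 yw0 zw0 (act_iota (sfst (sfst u))) (act_iota (ssnd (sfst u))) (act_iota (ssnd u)).
by rewrite spair_eta cpairE.
Qed.

Lemma F_X_YZ_tildeH_XY_Z_cls :
  F_X_YZ (tildeH_XY_Z (cls k u)) = tildeH_XY_Z (F_X_YZ (cls k u)).
Proof.
rewrite -fw0 H_XY_Zf // F_X_YZf //.
rewrite (linear_Hpath (@F_X_YZ k X Y Z)) (linear_Fpath (@tildeH_XY_Z k X Y Z)).
rewrite (eq_Hpath_valid le_vertex_refl le_vertex_trans mixZ_le mixZxx vw0 F_X_YZf).
rewrite (eq_Fpath_valid le_vertex_refl le_vertex_trans mixX_le mixXxx vw0 H_XY_Zf).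
apply: (HpathZ_FpathX (qX := xcoord) (qZ := zcoord)) nf => //.
  exact: mixX_xcoord.
exact: mixZ_zcoord.
Qed.

Lemma F_XY_Z_tildeH_X_YZ_cls :
  F_XY_Z (tildeH_X_YZ (cls k u)) = tildeH_X_YZ (F_XY_Z (cls k u)).
Proof.
rewrite -fw0 H_X_YZf // F_XY_Zf //.
rewrite (linear_Hpath (@F_XY_Z k X Y Z)) (linear_Fpath (@tildeH_X_YZ k X Y Z)).
rewrite (eq_Hpath_valid le_vertex_refl le_vertex_trans mixX_le mixXxx vw0 F_XY_Zf).
rewrite (eq_Fpath_valid le_vertex_refl le_vertex_trans mixZ_le mixZxx vw0 H_X_YZf).
apply: (HpathX_FpathZ (qX := xcoord) (qZ := zcoord)) nf => //.
  exact: mixX_xcoord.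
exact: mixZ_zcoord.
Qed.

Lemma tildeH_anticomm_cls :
  tildeH_XY_Z (tildeH_X_YZ (cls k u)) = - tildeH_X_YZ (tildeH_XY_Z (cls k u)).
Proof.
rewrite -fw0 H_X_YZf // H_XY_Zf //.
rewrite (linear_Hpath (@tildeH_XY_Z k X Y Z)) (linear_Hpath (@tildeH_X_YZ k X Y Z)).
rewrite (eq_Hpath_valid le_vertex_refl le_vertex_trans mixX_le mixXxx vw0 H_XY_Zf).
rewrite (eq_Hpath_valid le_vertex_refl le_vertex_trans mixZ_le mixZxx vw0 H_X_YZf).
apply: (Hpath_anticomm (qX := xcoord) (qZ := zcoord)) nf => //.
  exact: mixX_xcoord.
exact: mixZ_zcoord.
Qed.
End Reassociation.

Theorem corollary4p7 (k : comPzRingType) (X Y Z : sset) :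
  [/\ forall c : C k (sprod (sprod X Y) Z),
        F_X_YZ (tildeH_XY_Z c) = tildeH_XY_Z (F_X_YZ c),
      forall c : C k (sprod (sprod X Y) Z),
        F_XY_Z (tildeH_X_YZ c) = tildeH_X_YZ (F_XY_Z c)
    & forall c : C k (sprod (sprod X Y) Z),
        tildeH_XY_Z (tildeH_X_YZ c) = - tildeH_X_YZ (tildeH_XY_Z c)].
Proof.
split.
- exact: (eq_linear_C (f := @F_X_YZ k X Y Z \o @tildeH_XY_Z k X Y Z)
    (g := @tildeH_XY_Z k X Y Z \o @F_X_YZ k X Y Z) (@F_X_YZ_tildeH_XY_Z_cls k X Y Z)).
- exact: (eq_linear_C (f := @F_XY_Z k X Y Z \o @tildeH_X_YZ k X Y Z)
    (g := @tildeH_X_YZ k X Y Z \o @F_XY_Z k X Y Z) (@F_XY_Z_tildeH_X_YZ_cls k X Y Z)).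
- exact: (eq_linear_C (f := @tildeH_XY_Z k X Y Z \o @tildeH_X_YZ k X Y Z)
    (g := -%R \o (@tildeH_X_YZ k X Y Z \o @tildeH_XY_Z k X Y Z)) (@tildeH_anticomm_cls k X Y Z)).
Qed.
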